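(* Let $N$ be a nilpotent structure of nilpotence index $n$ on a manifold $\mathcal M$, let $\mathcal U\subset\mathcal M$ be an open set on which the foliations $\mathcal I$ and $\mathcal K^a$ are trivial, let $\mathbb M$ be an $\mathbb R[\nu]$-module and let $f\in C^{n-1}(\mathcal U,\mathbb M)$. Then $f$ is nilomorphic for $N$ if and only if, in any nilomorphic coordinate system $(z_i)_{i=1}^D=(x_i+(\nu y_i))_{i=1}^D$, it reads $$f=\sum_\alpha\frac1{\alpha!}\,\frac{\partial^{|\alpha|}\check f}{\partial x^\alpha}\,(\nu y)^\alpha ,$$ where $\check f$ is some adapted function of the coordinates $(x_i)_{i=1}^D$, and where $\alpha=(\alpha_i)_{i=1}^D\in\mathbb N^D$ is a multi-index, $|\alpha|=\sum_i\alpha_i$, $\alpha!=\prod_i\alpha_i!$, $\frac{\partial^{|\alpha|}}{\partial x^\alpha}=\frac{\partial^{\alpha_1}}{\partial x_1^{\alpha_1}}\cdots\frac{\partial^{\alpha_D}}{\partial x_D^{\alpha_D}}$ and $(\nu y)^\alpha=\prod_{i=1}^D(\nu y_i)^{\alpha_i}$.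
   Context: Nilpotent structure: a field $N$ of endomorphisms of $T\mathcal M$, nilpotent of index $n$ ($N^{n-1}\neq N^n=0$), which is integrable, i.e. has constant matrix in suitable local coordinates. Set $\mathbb R[\nu]:=\mathbb R[X]/(X^n)$ with $\nu$ the class of $X$. Foliations: $\mathcal I$ is the foliation tangent to $\operatorname{Im}N$ and $\mathcal K^a$ the foliation tangent to $\ker N^a$; $\mathcal U$ is an open set on which they are trivial, and $\pi:\mathcal U\to\mathcal U/\mathcal I$ is the projection; $\pi(\mathcal K^a)$ is the image foliation on $\mathcal U/\mathcal I$. Coordinates: $D$ is the number of Jordan blocks of $N$. $N$-integral coordinates are local coordinates $(x_i,(y_{i,a})_{a=1}^{n(i)-1})_{i=1}^D$ with $\frac{\partial}{\partial y_{i,a}}=N^a\frac{\partial}{\partial x_i}$ for $1\le a\le n(i)-1$ and $N^{n(i)}\frac{\partial}{\partial x_i}=0$, where $n(1)\le\dots\le n(D)$ are the sizes of the Jordan blocks. Set $(\nu y_i):=\sum_{a=1}^{n(i)-1}\nu^ay_{i,a}\in\mathbb R[\nu]$ and $z_i:=x_i+(\nu y_i)$; the $(z_i)_i$ are called nilomorphic coordinates. The $(x_i)_i$ are coordinates on $\mathcal U/\mathcal I$. In the sum, all terms with $|\alpha|\ge n$ vanish since $\nu^n=0$. Nilomorphic function: a differentiable function $f$ with values in an $\mathbb R[\nu]$-module $\mathbb M$ such that $\mathrm df\circ N=\nu\,\mathrm df$. Adapted function: a function $\check f:\mathcal U/\mathcal I\to\mathbb M$ such that, for each $a\in\{0,\dots,n-1\}$,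 $\nu^a\check f$ is constant along the leaves of $\pi(\mathcal K^a)$.
   Formalization: f is additionally assumed differentiable on U; this is automatic for n ≥ 2, but for n = 1 (N = 0, ν = 0) a continuous non-differentiable f has the expansion (f equals f̌) without being nilomorphic, so the equivalence as stated fails there. *)

(* Defs.v *)
From HB Require Import structures.
From mathcomp Require Export all_boot all_order all_algebra.
From mathcomp Require Export qpoly.
From mathcomp Require Export all_classical all_reals all_analysis.
Export numFieldNormedType.Exports.

Set Implicit Arguments.
Unset Strict Implicit.
Unset Printing Implicit Defensive.

Import Order.TTheory GRing.Theory Num.Theory.
Local Open Scope classical_set_scope.
Local Open Scope ring_scope.

Definition partial (R : realType) (m : nat) (W : normedModType R) (j : 'I_m)
    (F : 'rV[R]_m -> W) : 'rV[R]_m -> W :=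
  fun u => 'D_(delta_mx 0 j) F u.

(* Meant for an open set A: F is of class C^k on A. *)
Fixpoint Ck (R : realType) (m : nat) (W : normedModType R) (k : nat)
    (A : set 'rV[R]_m) (F : 'rV[R]_m -> W) : Prop :=
  match k with
  | 0 => forall u, A u -> {for u, continuous F}
  | k'.+1 => (forall u, A u -> differentiable F u) /\
             (forall j, Ck k' A (partial j F))
  end.

(* d^|al| g / dx^al, with d/dx_1 applied last. *)
Definition mpartial (R : realType) (D n : nat) (W : normedModType R)
    (al : {ffun 'I_D -> 'I_n}) (g : 'rV[R]_D -> W) : 'rV[R]_D -> W :=
  foldr (fun i h => iter (al i) (partial i) h) g (enum 'I_D).

(* Only the values of [coord] on [dom] and of [cinv] on [coord @` dom] are
   meaningful. *)
Record chart (R : realType) (T : topologicalType) (m : nat) := Chart {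
  dom : set T;
  coord : T -> 'rV[R]_m;
  cinv : 'rV[R]_m -> T
}.

Definition is_chart (R : realType) (T : topologicalType) (m : nat)
    (c : chart R T m) : Prop :=
  [/\ open (dom c), open (coord c @` dom c),
      forall p, dom c p -> cinv c (coord c p) = p,
      forall p, dom c p -> {for p, continuous (coord c)}
    & forall u, (coord c @` dom c) u -> {for u, continuous (cinv c)}].

Definition transition (R : realType) (T : topologicalType) (m : nat)
    (c c' : chart R T m) : 'rV[R]_m -> 'rV[R]_m := coord c' \o cinv c.

Definition smooth_transition (R : realType) (T : topologicalType) (m : nat)
    (c c' : chart R T m) : Prop :=
  forall k, Ck k (coord c @` (dom c `&` dom c')) (transition c c').

(* A smooth m-dimensional manifold structure on T; the atlas is maximal, so its
   elements are all the local coordinate systems of the manifold. *)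
Record manifold (R : realType) (T : topologicalType) (m : nat) := Manifold {
  atlas : set (chart R T m);
  manifold_hausdorff : hausdorff_space T;
  manifold_countable : @second_countable T;
  atlas_chart : forall c, atlas c -> is_chart c;
  atlas_cover : forall p, exists2 c, atlas c & dom c p;
  atlas_smooth : forall c c', atlas c -> atlas c' -> smooth_transition c c';
  atlas_max : forall c, is_chart c ->
    (forall c', atlas c' -> smooth_transition c c' /\ smooth_transition c' c) ->
    atlas c
}.

Definition Ck_on (R : realType) (T : topologicalType) (m : nat)
    (X : manifold R T m) (W : normedModType R) (k : nat) (U : set T)
    (f : T -> W) : Prop :=
  forall c, atlas X c -> Ck k (coord c @` (dom c `&` U)) (f \o cinv c).

Definition differentiable_on (R : realType) (T : topologicalType) (m : nat)
    (X : manifold R T m) (W : normedModType R) (U : set T)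
    (f : T -> W) : Prop :=
  forall c p, atlas X c -> dom c p -> U p ->
    differentiable (f \o cinv c) (coord c p).

Definition smooth_map_on (R : realType) (T T' : topologicalType) (m m' : nat)
    (X : manifold R T m) (X' : manifold R T' m') (U : set T)
    (h : T -> T') : Prop :=
  (forall p, U p -> {for p, continuous h}) /\
  (forall c c', atlas X c -> atlas X' c' -> forall k,
     Ck k (coord c @` (dom c `&` U `&` h @^-1` dom c'))
        (coord c' \o h \o cinv c)).

(* A tangent vector at p is represented, in each chart around p, by the row
   vector v of its components; the endomorphism of matrix A is v |-> v *m A.
   With 'J the library's Jacobian ('d f u v = v *m 'J f u), the compatibility
   condition says that the matrices in two charts are conjugate under the
   differential of the change of coordinates. *)
Record endo_field (R : realType) (T : topologicalType) (m : nat)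
    (X : manifold R T m) := EndoField {
  endo :> chart R T m -> T -> 'M[R]_m;
  endo_compat : forall c c' p, atlas X c -> atlas X c' -> dom c p -> dom c' p ->
    endo c p *m ('J (transition c c') (coord c p)) =
    ('J (transition c c') (coord c p)) *m endo c' p
}.

Definition integrable_field (R : realType) (T : topologicalType) (m : nat)
    (X : manifold R T m) (N : endo_field X) : Prop :=
  forall p, exists c, [/\ atlas X c, dom c p &
    exists A : 'M[R]_m, forall q, dom c q -> N c q = A].

(* The two conditions on powers force 0 < n. *)
Definition nilpotent_structure (R : realType) (T : topologicalType) (m : nat)
    (X : manifold R T m) (n : nat) (N : endo_field X) : Prop :=
  [/\ forall c p, atlas X c -> dom c p -> N c p ^+ n = 0,
      exists c p, [/\ atlas X c, dom c p & N c p ^+ n.-1 != 0]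
    & integrable_field N].

(* A distribution, given in each chart by a matrix whose row space consists of
   the tangent vectors belonging to it. *)
Definition distribution (R : realType) (T : topologicalType) (m : nat) :=
  chart R T m -> T -> 'M[R]_m.

Definition ImN (R : realType) (T : topologicalType) (m : nat)
    (X : manifold R T m) (N : endo_field X) : distribution R T m :=
  fun c p => N c p.

Definition KerN (R : realType) (T : topologicalType) (m : nat)
    (X : manifold R T m) (N : endo_field X) (a : nat) : distribution R T m :=
  fun c p => kermx (N c p ^+ a).

(* The leaf through p, inside V, of the foliation tangent to Delta: the points
   that can be joined to p, inside V, by a differentiable curve tangent to
   Delta. *)
Definition leaf (R : realType) (T : topologicalType) (m : nat)
    (X : manifold R T m) (Delta : distribution R T m) (V : set T) (p : T) :
    set T :=
  [set q | exists gam : R -> T,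
     [/\ gam 0 = p, gam 1 = q &
      forall t, 0 <= t <= 1 ->
        [/\ V (gam t), {for t, continuous gam} &
         forall c, atlas X c -> dom c (gam t) ->
           derivable (coord c \o gam) t 1 /\
           ('D_1 (coord c \o gam) t <= Delta c (gam t))%MS]]].

(* The foliation tangent to Delta is trivial on U: there is a diffeomorphism
   (l, b) of U onto a product L x B, with L connected, mapping the leaves to
   the L x {w}, i.e. Delta = ker db. The diffeomorphism is expressed as a smooth
   bijection whose differential is everywhere invertible. *)
Definition trivial_foliation (R : realType) (T : topologicalType) (m : nat)
    (X : manifold R T m) (Delta : distribution R T m) (U : set T) : Prop :=
  exists (r s : nat) (L B : topologicalType)
         (XL : manifold R L r) (XB : manifold R B s) (l : T -> L) (b : T -> B),
  [/\ connected [set: L], (r + s = m)%N,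
      smooth_map_on X XL U l /\ smooth_map_on X XB U b,
      set_bij U [set: L * B] (fun p => (l p, b p))
    & forall p c cl cb, U p -> atlas X c -> dom c p ->
        atlas XL cl -> dom cl (l p) -> atlas XB cb -> dom cb (b p) ->
        let dl := 'd (coord cl \o l \o cinv c) (coord c p) in
        let db := 'd (coord cb \o b \o cinv c) (coord c p) in
        (forall v : 'rV[R]_m, dl v = 0 -> db v = 0 -> v = 0) /\
        (forall v : 'rV[R]_m, (v <= Delta c p)%MS <-> db v = 0)].

Notation Rnu R n := {poly %/ ('X^n : {poly R})}.

(* An R[nu]-module structure on M, compatible with its real normed space
   structure and acting continuously (automatic in finite dimension). *)
Record nu_module (R : realType) (n : nat) (M : normedModType R) := NuModule {
  act :> Rnu R n -> M -> M;
  act_cont : forall a, continuous (act a);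
  actA : forall a b x, act a (act b x) = act (a * b) x;
  act1 : forall x, act 1 x = x;
  actDr : forall a x y, act a (x + y) = act a x + act a y;
  actDl : forall a b x, act (a + b) x = act a x + act b x;
  act_scalar : forall (k : R) x, act (k *: 1) x = k *: x
}.

Definition nilomorphic (R : realType) (T : topologicalType) (m : nat)
    (X : manifold R T m) (N : endo_field X) (n : nat) (M : normedModType R)
    (nuM : nu_module n M) (U : set T) (f : T -> M) : Prop :=
  differentiable_on X U f /\
  forall c p, atlas X c -> dom c p -> U p -> forall v : 'rV[R]_m,
    'd (f \o cinv c) (coord c p) (v *m N c p) =
    nuM 'qX ('d (f \o cinv c) (coord c p) v).

(* [lab i a] is the index, among the m components of the chart, of x_i if a = 0
   and of y_{i,a} if 0 < a < s i. *)
Definition xcoord (R : realType) (T : topologicalType) (m D : nat)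
    (c : chart R T m) (lab : 'I_D -> nat -> 'I_m) (p : T) : 'rV[R]_D :=
  \row_i coord c p 0 (lab i 0%N).

Definition nuy (R : realType) (T : topologicalType) (m D : nat) (n : nat)
    (s : 'I_D -> nat) (c : chart R T m) (lab : 'I_D -> nat -> 'I_m)
    (i : 'I_D) (p : T) : Rnu R n :=
  \sum_(1 <= a < s i) coord c p 0 (lab i a) *: ('qX : Rnu R n) ^+ a.

(* The projection V -> V/I onto the space of leaves in V of the foliation
   tangent to Im N; points of V/I are leaves. *)
Definition proj (R : realType) (T : topologicalType) (m : nat)
    (X : manifold R T m) (N : endo_field X) (V : set T) (p : T) : set T :=
  leaf X (ImN N) V p.

(* N-integral coordinates (x_i, y_{i,a}) defined on an open subset [dom c] of U,
   with Jordan blocks of sizes s 0 <= s 1 <= ..., such that the x_i are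
   coordinates on (dom c)/I. *)
Record nilomorphic_coordinates (R : realType) (T : topologicalType) (m : nat)
    (X : manifold R T m) (N : endo_field X) (U : set T) (D : nat)
    (s : 'I_D -> nat) (c : chart R T m) (lab : 'I_D -> nat -> 'I_m) : Prop :=
  NilomorphicCoordinates {
  nc_atlas : atlas X c;
  nc_sub : dom c `<=` U;
  nc_pos : forall i, (0 < s i)%N;
  nc_sorted : forall i j : 'I_D, (i <= j)%N -> (s i <= s j)%N;
  nc_lab : set_bij [set ia : 'I_D * nat | (ia.2 < s ia.1)%N] [set: 'I_m]
             (fun ia => lab ia.1 ia.2);
  nc_integral : forall p, dom c p -> forall (i : 'I_D) (a : nat), (a < s i)%N ->
    delta_mx 0 (lab i a) = delta_mx 0 (lab i 0%N) *m N c p ^+ a :> 'rV[R]_m;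
  nc_end : forall p, dom c p -> forall i : 'I_D,
    delta_mx 0 (lab i 0%N) *m N c p ^+ s i = 0 :> 'rV[R]_m;
  nc_proj : forall p q, dom c p -> dom c q ->
    (xcoord c lab p = xcoord c lab q <-> proj N (dom c) p = proj N (dom c) q)
}.

(* fc : V/I -> M is adapted: for each a < n, nu^a fc is constant along the leaves
   of pi(K^a), which are the images by pi of the leaves of K^a. *)
Definition adapted (R : realType) (T : topologicalType) (m : nat)
    (X : manifold R T m) (N : endo_field X) (n : nat) (M : normedModType R)
    (nuM : nu_module n M) (V : set T) (fc : set T -> M) : Prop :=
  forall a p, (a < n)%N -> V p -> forall A B : set T,
    (proj N V @` leaf X (KerN N a) V p) A ->
    (proj N V @` leaf X (KerN N a) V p) B ->
    nuM ('qX ^+ a) (fc A) = nuM ('qX ^+ a) (fc B).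

(* The right-hand side of the expansion, g being fc read in the coordinates x.
   The sum is restricted to |al| < n, which also bounds each al i by n. *)
Definition nilo_expansion (R : realType) (T : topologicalType) (m D : nat)
    (n : nat) (s : 'I_D -> nat) (c : chart R T m) (lab : 'I_D -> nat -> 'I_m)
    (M : normedModType R) (nuM : nu_module n M) (g : 'rV[R]_D -> M) (p : T) : M :=
  \sum_(al : {ffun 'I_D -> 'I_n} | (\sum_i al i < n)%N)
    ((\prod_i (al i)`!)%:R : R)^-1 *:
      nuM (\prod_i nuy n s c lab i p ^+ al i) (mpartial al g (xcoord c lab p)).

(* Main.v *)
From HB Require Import structures.
Require Import Defs.
From mathcomp Require Import ring lra zify.

Set Implicit Arguments.
Unset Strict Implicit.
Unset Printing Implicit Defensive.
Import Order.TTheory GRing.Theory Num.Theory.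
Local Open Scope classical_set_scope.
Local Open Scope ring_scope.

(** Read in N-integral coordinates (x, y), the equation df o N = nu df says
    d f / d y_(i,b) = nu^b d f / d x_i, together with nu^(s i) d f / d x_i = 0,
    where s i is the size of the i-th Jordan block.  Moving in the y-directions
    is therefore moving x_i by the nilpotent amount (nu y_i), and the expansion
    is the Taylor formula of f in these directions, which is exact because
    nu^n = 0.

    Suppose f nilomorphic.  The exact Taylor formula between two points with the
    same x ([taylor_blocks]) is proved one block at a time, by descending
    induction on the power of nu in front of f: if nu^(a+1) f is known, then
    the y-derivative of nu^a f is known, because each y-derivative brings a
    factor nu.  Only derivatives that f really has are taken, as a coefficient
    divisible by nu^k multiplies each derivative of order k.  Blocks are moved
    from the last to the first, so that the partial derivatives come out in the
    order prescribed by the multi-index and never have to be commuted.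

    The adapted function is the value of f at y = 0, which may lie outside the
    coordinate domain.  It is reached by extrapolation: on the ray
    tau -> (x, tau y) the function f is a polynomial of degree < n in tau, so a
    linear combination of the values f (x, tau_j y), with tau_j close to 1 and
    with constant coefficients, gives the value at tau = 0
    ([extrapolation], [local_formula]).  This combination shows that the trace
    is of class C^(n-1), although each coefficient of the expansion seems to
    lose derivatives, and it gives the expansion itself
    ([x_trace_expansion]).  The extrapolated value is locally constant in y,
    hence constant on the leaves of Im N, which are connected by curves
    ([centre_leaf]); differentiating it along curves tangent to ker N^a gives
    adaptedness ([x_trace_leaf_KerN]).

    Conversely the equation has to be checked at each point p, and there exist
    nilomorphic coordinates centred at p, with a box as domain
    ([centred_coordinates]): a Jordan basis of the constant matrix of N gives a
    linear change of an integrable chart, and in a box the leaves of Im N are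
    the level sets of x.  At the centre y = 0, so the expansion gives at once
    d f / d y_(i,b) = nu^b d g / d x_i and d f / d x_i = d g / d x_i, and
    adaptedness gives nu^(s i) d g / d x_i = 0 ([nilomorphic_at_centre]). *)

(** * Calculus on open sets of row vectors *)

Section Calculus.
Variable R : realType.

(** The distance to a fixed point moves no faster than the curve; this
    reduces vanishing of vector-valued derivatives to real functions, for which
    the mean value theorem is available. *)
Lemma is_derive_norm0 (M : normedModType R) (phi : R -> M) (x0 : M) (t : R) :
  is_derive t 1 phi 0 -> is_derive t 1 (fun s => `|phi s - x0|) 0.
Proof.
move=> [dphi phi0].
have cv : (fun h : R => h^-1 *: ((phi \o shift t) (h *: 1) - phi t)) @ 0^' --> (0 : M).
  by rewrite -phi0; exact: dphi.
suff cv' : (fun h : R => h^-1 *: (((fun s => `|phi s - x0|) \o shift t) (h *: 1) -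
     `|phi t - x0|)) @ 0^' --> (0 : R).
  by apply: DeriveDef; [apply/cvg_ex; exists 0|apply: cvg_lim].
apply/cvgr0Pnorm_le => e e0; move/cvgr0Pnorm_le: cv => /(_ e e0).
apply: filterS => h; apply: le_trans.
rewrite normrM normrZ ler_wpM2l//=.
apply: le_trans (ler_dist_dist _ _) _.
by rewrite opprB addrA subrK.
Qed.

Lemma derive0_constant (M : normedModType R) (phi : R -> M) (a b : R) :
  a <= b -> {within `[a, b], continuous phi} ->
  (forall t : R, a < t < b -> is_derive t 1 phi 0) -> phi b = phi a.
Proof.
move=> ab cphi dphi; pose h t := `|phi t - phi a|.
have dh t : t \in `]a, b[%R -> is_derive (t : R) 1 h 0.
  by rewrite in_itv/= => /dphi; exact: is_derive_norm0.
have ch : {within `[a, b], continuous h}.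
  move=> t; apply: (@continuous_comp (subspace `[a, b]) M R phi (fun y : M => `|y - phi a|)).
    exact: cphi.
  apply: (@continuous_comp _ _ _ (fun y : M => y - phi a) (fun y : M => `|y|)).
    by apply: cvgB; [exact: cvg_id|exact: cvg_cst].
  exact: norm_continuous.
have [c _] := MVT_segment ab dh ch.
by rewrite mul0r /h subrr normr0 subr0 => /eqP; rewrite normr_eq0 subr_eq0 => /eqP.
Qed.

Lemma derive0_segment (M : normedModType R) (phi : R -> M) (a b : R) :
  a <= b -> (forall t : R, a <= t <= b -> is_derive t 1 phi 0) -> phi b = phi a.
Proof.
move=> ab dphi; apply: derive0_constant => //.
  by apply: derivable_within_continuous => t; rewrite in_itv /= => /dphi [].
by move=> t /andP[t0 t1]; apply: dphi; rewrite !ltW.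
Qed.

Section CkCalculus.
Variables (m : nat) (W : normedModType R).
Implicit Types (A : set 'rV[R]_m) (F G : 'rV[R]_m -> W) (u : 'rV[R]_m).

(** Being of class C^k on a set is a condition at each of its points; this
    is what makes the class local. *)
Lemma Ck_pointwise k A F : Ck k A F <-> forall u, A u -> Ck k [set u] F.
Proof.
elim: k A F => [|k IH] A F /=.
  by split=> [h u Au _ -> |h u Au]; [exact: h|exact: (h u Au)].
split=> [[dF pF] u Au|h].
  split=> [_ -> |j]; first exact: dF.
  by apply: (IH _ _).1 Au; exact: pF.
split=> [u Au|j]; first by apply: (h u Au).1.
by apply/IH => u Au; exact: (h u Au).2.
Qed.

Lemma Ck_sub k A B F : B `<=` A -> Ck k A F -> Ck k B F.
Proof. by move=> BA /Ck_pointwise h; apply/Ck_pointwise => u /BA; exact: h. Qed.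

Lemma partial_near j F G u :
  (\forall v \near u, F v = G v) -> \forall v \near u, partial j F v = partial j G v.
Proof. by move=> /nbhs_interior FG; apply: filterS FG => v H; exact: near_eq_derive. Qed.

Lemma differentiable_near F G u :
  (\forall v \near u, F v = G v) -> differentiable F u -> differentiable G u.
Proof.
move=> FG dF; have FGu : F u = G u by exact: nbhs_singleton FG.
apply/diffP => /=.
apply: (@getPex _ (fun (df : {linear 'rV[R]_m -> W}) => continuous df /\
  forall y, G y = G (lim (nbhs u)) + df (y - lim (nbhs u))
                  +o_(y \near u) (y - lim (nbhs u)))).
exists ('d F u); split; first exact: diff_continuous.
suff : G = cst (G u) + ('d F u \o center u) +o_u (center u).
  by rewrite funeqE lim_id.
apply/eqaddoP => e e0.
case: dF => -[cF /eqaddoP/(_ e e0)].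
rewrite lim_id//.
apply: filter_app; near=> v => /=.
have FGv : F v = G v by near: v.
rewrite -[(G - _) v]/(G v - (G u + 'd F u (v - u))) -FGv -FGu.
by [].
Unshelve. all: by end_near. Qed.

Lemma Ck_near k F G u :
  (\forall v \near u, F v = G v) -> Ck k [set u] F -> Ck k [set u] G.
Proof.
elim: k F G => [|k IH] F G FG /=.
  move=> h _ ->; rewrite /prop_for /continuous_at -(nbhs_singleton FG).
  apply: cvg_trans (h u erefl).
  by apply: (@near_eq_cvg _ _ (nbhs u)).
move=> [dF pF]; split=> [_ ->|j].
  by apply: differentiable_near FG _; exact: dF.
by apply: IH (pF j); exact: partial_near.
Qed.

Lemma Ck_eq k A F G : open A -> (forall u, A u -> F u = G u) ->
  Ck k A F -> Ck k A G.
Proof.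
move=> oA FG /Ck_pointwise h; apply/Ck_pointwise => u Au.
apply: Ck_near (h u Au); apply: filterS (open_nbhs_nbhs (conj oA Au)) => v.
exact: FG.
Qed.

Lemma CkS k A F : Ck k.+1 A F -> Ck k A F.
Proof.
elim: k F => [|k IH] F /= [dF pF].
  by move=> u /dF; exact: differentiable_continuous.
by split=> // j; apply: IH; exact: pF.
Qed.

Lemma Ck_le k l A F : (k <= l)%N -> Ck l A F -> Ck k A F.
Proof.
by move=> /subnK <-; elim: (l - k)%N => [//|i IH]; rewrite addSn => /CkS.
Qed.

Lemma Ck_cst k A (w : W) : Ck k A (fun=> w).
Proof.
elim: k w => [|k IH] w /=.
  by move=> u _; exact: cst_continuous.
split=> [u _|j]; first exact: differentiable_cst.
rewrite (_ : partial j _ = fun=> 0); first exact: IH.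
by apply/funext => u; exact: derive_cst.
Qed.

Lemma CkD k A F G : open A -> Ck k A F -> Ck k A G ->
  Ck k A (fun u => F u + G u).
Proof.
move=> oA; elim: k F G => [|k IH] F G /=.
  by move=> cF cG u Au; exact: (continuousD (cF u Au) (cG u Au)).
move=> [dF pF] [dG pG]; split=> [u Au|j].
  by apply: differentiableD; [exact: dF|exact: dG].
apply: Ck_eq (IH _ _ (pF j) (pG j)) => // u Au.
by rewrite /partial deriveD//; apply: diff_derivable; [exact: dF|exact: dG].
Qed.

Lemma Ck_sum k A (I : Type) (r : seq I) (P : pred I) (F : I -> 'rV[R]_m -> W) :
  open A -> (forall i, P i -> Ck k A (F i)) ->
  Ck k A (fun u => \sum_(i <- r | P i) F i u).
Proof.
move=> oA CF; elim: r => [|i r IH].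
  rewrite (_ : (fun _ => _) = fun=> 0); first exact: Ck_cst.
  by apply/funext => u; rewrite big_nil.
case Pi: (P i); last first.
  by apply: Ck_eq IH => // u _; rewrite big_cons Pi.
by apply: Ck_eq (CkD oA (CF i Pi) IH) => // u _; rewrite big_cons Pi.
Qed.

End CkCalculus.

Section linear_maps.
Variables (W W' : normedModType R) (L : {linear W -> W'}).
Hypothesis cL : continuous L.

Lemma derive_linear (V : normedModType R) (F : V -> W) (u v : V) :
  differentiable F u -> 'D_v (L \o F) u = L ('D_v F u).
Proof.
move=> dF; have dL w : differentiable L w by exact: linear_differentiable.
rewrite !deriveE//; last exact: differentiable_comp.
by rewrite diff_comp// /= diff_lin.
Qed.

Lemma Ck_linear m k (A : set 'rV[R]_m) F : open A -> Ck k A F -> Ck k A (L \o F).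
Proof.
move=> oA; elim: k F => [|k IH] F /=.
  by move=> cF u Au; apply: continuous_comp; [exact: cF|exact: cL].
move=> [dF pF]; split=> [u Au|j].
  by apply: differentiable_comp; [exact: dF|exact: linear_differentiable].
by apply: Ck_eq (IH _ (pF j)) => // u Au; rewrite /partial derive_linear//; exact: dF.
Qed.

End linear_maps.

Lemma CkZ m (W : normedModType R) k (A : set 'rV[R]_m) (F : 'rV[R]_m -> W) (c : R) :
  open A -> Ck k A F -> Ck k A (fun u => c *: F u).
Proof.
move=> oA CF; apply: (@Ck_linear _ _ (GRing.scale c)) => //.
exact: scaler_continuous.
Qed.

Lemma row_linear_continuous a (W : normedModType R)
  (L : {linear 'rV[R]_a -> W}) : continuous L.
Proof.
pose S (r : seq 'I_a) (x : 'rV[R]_a) : W := \sum_(j <- r) x 0 j *: L (delta_mx 0 j).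
have -> : L = S (index_enum 'I_a) :> (_ -> _).
  apply/funext => y; rewrite [in LHS](row_sum_delta y) linear_sum.
  by apply: eq_bigr => j _; rewrite linearZ.
elim: (index_enum 'I_a) => [|j r IH].
  have -> : S [::] = fun=> 0 by apply/funext => x; rewrite /S big_nil.
  exact: cst_continuous.
have -> : S (j :: r) = fun x => x 0 j *: L (delta_mx 0 j) + S r x.
  by apply/funext => x; rewrite /S big_cons.
move=> x; apply: (@continuousD _ _ _ (fun x : 'rV[R]_a => x 0 j *: L (delta_mx 0 j))).
  exact: (cvgZr_tmp (@coord_continuous R 1 a 0 j x)).
exact: IH.
Qed.

Section precomposition.
Variables (a b : nat) (W : normedModType R) (L : {linear 'rV[R]_a -> 'rV[R]_b}).
Variable z : 'rV[R]_b.

Lemma derive_precomp (F : 'rV[R]_b -> W) (x v : 'rV[R]_a) :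
  'D_v (fun x => F (L x + z)) x = 'D_(L v) F (L x + z).
Proof.
rewrite /derive; set f1 := fun h => _; set f2 := fun h => _.
suff -> : f1 = f2 by [].
apply/funext => h; rewrite /f1 /f2 /=.
have -> : L (h *: v + x) = h *: L v + L x by exact: linearP.
by rewrite addrA.
Qed.

Lemma open_affine (A : set 'rV[R]_b) : open A -> open [set x | A (L x + z)].
Proof.
move=> oA; apply: (@open_comp _ _ (fun x => L x + z)) oA => x _.
apply: (@continuousD _ _ _ L (fun=> z)); last exact: cst_continuous.
exact: row_linear_continuous.
Qed.

(** By the chain rule the partial derivatives of [F (L x + z)] are constant
    combinations of those of [F], so the class is preserved by induction. *)
Lemma Ck_precomp k (A : set 'rV[R]_b) (F : 'rV[R]_b -> W) :
  open A -> Ck k A F ->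
  Ck k [set x | A (L x + z)] (fun x => F (L x + z)).
Proof.
move=> oA; have cLz : continuous (fun x => L x + z).
  move=> x; apply: (@continuousD _ _ _ L (fun=> z)); last exact: cst_continuous.
  exact: row_linear_continuous.
have oLA : open [set x | A (L x + z)].
  exact: (open_comp (fun x _ => cLz x)).
elim: k F => [|k IH] F /=.
  by move=> cF x Ax; apply: (continuous_comp (cLz x)); exact: cF.
move=> [dF pF]; split=> [x Ax|j].
  apply: (@differentiable_comp _ _ _ _ (fun x => L x + z) F); last exact: dF.
  apply: differentiableD; last exact: differentiable_cst.
  exact/linear_differentiable/row_linear_continuous.
pose G x := \sum_k (L (delta_mx 0 j)) 0 k *: partial k F (L x + z).
apply: (@Ck_eq _ _ _ _ G) => //.
  move=> x Ax; rewrite /partial derive_precomp deriveE; last exact: dF.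
  rewrite [X in 'd _ _ X]row_sum_delta linear_sum; apply: eq_bigr => i _.
  by rewrite linearZ /= /partial deriveE//; exact: dF.
apply: Ck_sum => // i _; apply: CkZ => //; apply: IH; exact: pF.
Qed.

End precomposition.
End Calculus.

(** * Partial derivatives and the action of the nilpotent algebra *)

Section NuModuleTheory.
Variables (R : realType) (n : nat) (M : normedModType R) (nuM : nu_module n M).

Lemma actZr (a : Rnu R n) (k : R) (x : M) : nuM a (k *: x) = k *: nuM a x.
Proof. by rewrite -!(act_scalar nuM) !actA mulrC. Qed.

Lemma act_is_linear (a : Rnu R n) : linear (nuM a).
Proof. by move=> k x y; rewrite actDr actZr. Qed.

HB.instance Definition _ (a : Rnu R n) :=
  GRing.isLinear.Build R M M *:%R (act nuM a) (act_is_linear a).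

Lemma actZl (k : R) (a : Rnu R n) (x : M) : nuM (k *: a) x = k *: nuM a x.
Proof. by rewrite -[k *: a]mulr_algl -actA act_scalar. Qed.

Lemma act0l (x : M) : nuM 0 x = 0.
Proof. by rewrite -(scale0r (0 : Rnu R n)) actZl scale0r. Qed.

Lemma act_suml (I : Type) (r : seq I) (P : pred I) (c : I -> Rnu R n) (x : M) :
  nuM (\sum_(i <- r | P i) c i) x = \sum_(i <- r | P i) nuM (c i) x.
Proof.
apply: (big_morph (fun a => nuM a x)) => [a b|]; first exact: actDl.
exact: act0l.
Qed.

(** A term whose coefficient is zero may involve a function without any
    regularity: this is how derivatives beyond the available order, which always
    come with a vanishing power of nu, are allowed in the sums below. *)
Lemma is_derive_act_sum (V : normedModType R) (I : Type) (r : seq I)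
    (P : pred I) (c : I -> Rnu R n) (H : I -> V -> M) (u v : V) :
  (forall q, P q -> c q = 0 \/ differentiable (H q) u) ->
  is_derive u v (fun u => \sum_(q <- r | P q) nuM (c q) (H q u))
    (\sum_(q <- r | P q) nuM (c q) ('D_v (H q) u)).
Proof.
move=> dH; elim: r => [|q r IH].
  rewrite big_nil (_ : (fun _ => _) = cst 0); first exact: is_derive_cst.
  by apply/funext => w; rewrite big_nil.
rewrite big_cons (_ : (fun _ => _) = (fun u => (if P q then nuM (c q) (H q u) else 0) +
   \sum_(q <- r | P q) nuM (c q) (H q u))); last first.
  by apply/funext => w; rewrite big_cons; case: ifP; rewrite ?add0r.
case: ifPn => [Pq|_]; last first.
  by rewrite (_ : (fun _ => _) = (fun u => \sum_(q <- r | P q) nuM (c q) (H q u)))//;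
    apply/funext => w; rewrite add0r.
apply: is_deriveD; case: (dH q Pq) => [->|dq].
  rewrite act0l (_ : (fun _ => _) = cst 0); first exact: is_derive_cst.
  by apply/funext => w; rewrite act0l.
have dc : differentiable (nuM (c q) \o H q) u.
  by apply: differentiable_comp => //; apply/linear_differentiable/act_cont.
rewrite -(derive_linear (@act_cont _ _ _ nuM (c q)))//.
by apply: DeriveDef => //; exact: diff_derivable.
Qed.

End NuModuleTheory.

Section IteratedPartials.
Variables (R : realType) (W : normedModType R).

(** As in [mpartial], the head of the list is applied last. *)
Definition partials m (js : seq 'I_m) (F : 'rV[R]_m -> W) : 'rV[R]_m -> W :=
  foldr (@partial R m W) F js.

Lemma partials_cat m (js ks : seq 'I_m) (F : 'rV[R]_m -> W) :
  partials (js ++ ks) F = partials js (partials ks F).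
Proof. exact: foldr_cat. Qed.

Lemma Ck_partials m (js : seq 'I_m) (A : set 'rV[R]_m) (F : 'rV[R]_m -> W) k l :
  (size js + k <= l)%N -> Ck l A F -> Ck k A (partials js F).
Proof.
elim: js k l => [|j js IH] k l; first exact: Ck_le.
rewrite [size _]/= addSnnS => h /(IH _ _ h) [_]; exact.
Qed.

Lemma partials_eq m (js : seq 'I_m) (A : set 'rV[R]_m) (F G : 'rV[R]_m -> W) :
  open A -> (forall u, A u -> F u = G u) ->
  forall u, A u -> partials js F u = partials js G u.
Proof.
move=> oA FG; elim: js => [//|j js IH] u Au /=; apply: near_eq_derive.
by apply: filterS (open_nbhs_nbhs (conj oA Au)).
Qed.

(** As [L] sends basis vectors to basis vectors, both sides are limits of the
    same difference quotients. *)
Lemma partials_precomp a b (L : {linear 'rV[R]_a -> 'rV[R]_b}) (sg : 'I_a -> 'I_b)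
    (js : seq 'I_a) (F : 'rV[R]_b -> W) (z : 'rV[R]_b) (x : 'rV[R]_a) :
  (forall j, L (delta_mx 0 j) = delta_mx 0 (sg j)) ->
  partials js (fun x => F (L x + z)) x = partials (map sg js) F (L x + z).
Proof.
move=> Lsg; elim: js x => [//|j js IH] x /=.
rewrite {1}/partial (_ : partials js _ = fun x => partials (map sg js) F (L x + z)).
  by rewrite derive_precomp Lsg.
exact/funext.
Qed.

(** The list of indices, with multiplicities, along which [mpartial al]
    differentiates. *)
Definition index_seq D n (al : {ffun 'I_D -> 'I_n}) (l : seq 'I_D) : seq 'I_D :=
  flatten [seq nseq (al i) i | i <- l].

Lemma mpartialE D n (al : {ffun 'I_D -> 'I_n}) (g : 'rV[R]_D -> W) :
  mpartial al g = partials (index_seq al (enum 'I_D)) g.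
Proof.
rewrite /mpartial /index_seq; elim: (enum _) => [//|i l IH] /=.
rewrite partials_cat -IH; elim: (nat_of_ord (al i)) => [//|k IHk] /=.
by rewrite IHk.
Qed.

Lemma size_index_seq D n (al : {ffun 'I_D -> 'I_n}) (l : seq 'I_D) :
  size (index_seq al l) = (\sum_(i <- l) al i)%N.
Proof.
by elim: l => [|i l IH]; rewrite ?big_nil// big_cons size_cat size_nseq IH.
Qed.

End IteratedPartials.

(** As in [is_derive_act_sum], either the coefficient vanishes or the
    function is regular enough. *)
Lemma partials_act_sum (R : realType) n (M : normedModType R) (nuM : nu_module n M)
    m (js : seq 'I_m) (A : set 'rV[R]_m) (I : Type) (r : seq I) (P : pred I)
    (c : I -> Rnu R n) (H : I -> 'rV[R]_m -> M) :
  open A -> (forall q, P q -> c q = 0 \/ Ck (size js) A (H q)) ->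
  forall u, A u -> partials js (fun u => \sum_(q <- r | P q) nuM (c q) (H q u)) u =
    \sum_(q <- r | P q) nuM (c q) (partials js (H q) u).
Proof.
move=> oA; elim: js => [//|j js IH] CH u Au /=.
have dH q : P q -> c q = 0 \/ differentiable (partials js (H q)) u.
  move=> /CH[->|CHq]; [by left|right].
  have := @Ck_partials _ _ _ js A (H q) 1 (size (j :: js)).
  by rewrite addn1 leqnn => /(_ isT CHq)[/(_ u Au)].
rewrite /partial -(@derive_val _ _ _ _ _ _ _ (is_derive_act_sum nuM r (delta_mx 0 j) dH)).
apply: near_eq_derive; apply: filterS (open_nbhs_nbhs (conj oA Au)) => v Av.
apply: IH => // q /CH[->|/CkS CHq]; first by left.
by right.
Qed.

(** * Taylor formula along the nilpotent directions *)

Lemma qX_nilpotent (R : realType) n : ('qX : Rnu R n.+1) ^+ n.+1 = 0.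
Proof.
apply/val_inj; rewrite -[qpolyX _]/(in_qpoly _ 'X) -rmorphXn /=.
by rewrite mk_monic_Xn Pdiv.RingMonic.rmodpp ?monicXn.
Qed.

Lemma qXn_eq0 (R : realType) n k : (n.+1 <= k)%N -> ('qX : Rnu R n.+1) ^+ k = 0.
Proof. by move=> /subnK <-; rewrite exprD qX_nilpotent mulr0. Qed.

Lemma is_derive_scalel (R : realType) (M : normedModType R) (f : R -> R) (t df : R) (c : M) :
  is_derive t 1 f df -> is_derive t 1 (fun t => f t *: c) (df *: c).
Proof.
move=> [/derivable1_diffP ff <-].
have dfc : differentiable (fun t => f t *: c) t by exact: differentiableZl.
apply: DeriveDef; first exact/derivable1_diffP.
by rewrite !deriveE// diffZl.
Qed.

Lemma is_derive_vpoly (R : realType) (M : normedModType R) N (c : nat -> M) (t : R) :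
  is_derive t 1 (fun t => \sum_(k < N) t ^+ k *: c k)
     (\sum_(k < N) (k%:R * t ^+ k.-1) *: c k).
Proof.
elim: N => [|N IH].
  rewrite big_ord0 (_ : (fun _ => _) = cst 0); first exact: is_derive_cst.
  by apply/funext => x; rewrite big_ord0.
rewrite big_ord_recr (_ : (fun _ => _) = (fun t => (\sum_(k < N) t ^+ k *: c k) + t ^+ N *: c N)).
  apply: is_deriveD; apply: is_derive_scalel.
  by apply: DeriveDef; [exact: exprn_derivable|rewrite exp_derive [_ *: 1]mulr1].
by apply/funext => x; rewrite big_ord_recr.
Qed.

Lemma line_quotient (R : realType) (V M : normedModType R) (F : V -> M) (u y : V) (t : R) :
  (fun h : R => h^-1 *: (((fun t => F (u + t *: y)) \o shift t) (h *: 1) - F (u + t *: y))) =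
  (fun h => h^-1 *: ((F \o shift (u + t *: y)) (h *: y) - F (u + t *: y))).
Proof.
by apply/funext => h /=; rewrite [h *: 1]mulr1 scalerDl addrCA addrA.
Qed.

Lemma is_derive_line (R : realType) (V M : normedModType R) (F : V -> M) (u y : V) (t : R) :
  differentiable F (u + t *: y) ->
  is_derive t 1 (fun t => F (u + t *: y)) ('d F (u + t *: y) y).
Proof.
move=> dF; apply: DeriveDef; first by rewrite /derivable line_quotient; exact: diff_derivable.
by rewrite /derive line_quotient -deriveE.
Qed.

Lemma open_translate (R : realType) (V : normedModType R) (A : set V) (z : V) :
  open A -> open [set w | A (w + z)].
Proof.
move=> oA; apply: (@open_comp _ _ (fun w => w + z) A) => // w _.
apply: (@continuousD _ _ _ id (fun=> z)); first exact: (@cvg_id _ (nbhs w)).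
exact: cst_continuous.
Qed.

Section TaylorFormula.
Variables (R : realType) (m D n : nat) (s : 'I_D -> nat) (lab : 'I_D -> nat -> 'I_m).
Variables (M : normedModType R) (nuM : nu_module n.+1 M).
Hypothesis lab_inj : forall i j a b, (a < s i)%N -> (b < s j)%N ->
  lab i a = lab j b -> i = j /\ a = b.

Local Notation Rn := (Rnu R n.+1).
Local Notation nu := ('qX : Rn).

(** The element (nu y_i) of R[nu] attached to the i-th block. *)
Definition nu_y (u : 'rV[R]_m) (i : 'I_D) : Rn :=
  \sum_(1 <= a < s i) u 0 (lab i a) *: nu ^+ a.

(** The quotient of [nu_y] by nu; division by nu is not well defined in
    R[nu], hence an explicit formula. *)
Definition nu_y_quo (u : 'rV[R]_m) (i : 'I_D) : Rn :=
  \sum_(1 <= a < s i) u 0 (lab i a) *: nu ^+ a.-1.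

Lemma nu_y_factor u i : nu_y u i = nu * nu_y_quo u i.
Proof.
rewrite /nu_y /nu_y_quo mulr_sumr; apply: eq_big_nat => -[//|a] _.
by rewrite -scalerAr -exprS.
Qed.

Lemma nu_y_linear (x : R) u v i : nu_y (x *: u + v) i = x *: nu_y u i + nu_y v i.
Proof.
rewrite /nu_y scaler_sumr -big_split/=; apply: eq_bigr => a _.
by rewrite !mxE scalerDl scalerA.
Qed.

Lemma nu_y0 i : nu_y 0 i = 0.
Proof. by rewrite /nu_y big1// => a _; rewrite mxE scale0r. Qed.

Lemma nu_yZ (x : R) u i : nu_y (x *: u) i = x *: nu_y u i.
Proof. by rewrite -[x *: u]addr0 nu_y_linear nu_y0 addr0. Qed.

Definition is_y_label (l : seq 'I_D) (k : 'I_m) : bool :=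
  has (fun i => k \in [seq lab i a | a <- index_iota 1 (s i)]) l.

Definition y_blocks (l : seq 'I_D) (v : 'rV[R]_m) : 'rV[R]_m :=
  \row_k (if is_y_label l k then v 0 k else 0).

Lemma y_blocks1 i v : y_blocks [:: i] v = \sum_(1 <= a < s i) v 0 (lab i a) *: delta_mx 0 (lab i a).
Proof.
apply/rowP => k; rewrite mxE summxE /is_y_label /= orbF.
case: ifPn => [/mapP[a ain ->]|kn]; last first.
  rewrite big_seq big1// => a ain; rewrite !mxE eqxx /=.
  by case: eqP => [kE|_]; rewrite ?mulr0//; move: kn; rewrite kE map_f.
rewrite (bigD1_seq a) ?iota_uniq//= !mxE !eqxx mulr1 big_seq_cond big1 ?addr0//.
move=> b /andP[bin ba]; rewrite !mxE eqxx /=.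
case: eqP => [/lab_inj|_]; rewrite ?mulr0//.
move: ain bin; rewrite !mem_index_iota => /andP[_ ->] /andP[_ ->] /(_ isT isT)[_ ab].
by rewrite ab eqxx in ba.
Qed.

Lemma y_blocks_cons i l v : uniq (i :: l) -> y_blocks (i :: l) v = y_blocks l v + y_blocks [:: i] v.
Proof.
move=> /= /andP[il _]; apply/rowP => k; rewrite !mxE /is_y_label /= orbF.
have [/mapP[a]|] /= := boolP (k \in _); last by rewrite addr0.
rewrite mem_index_iota => /andP[_ as_] kE.
case: ifPn => [/hasP[j jl /mapP[b]]|_]; rewrite ?add0r//.
rewrite mem_index_iota kE => /andP[_ bs] /(lab_inj as_ bs)[ij _].
by rewrite ij jl in il.
Qed.

Lemma is_y_label_cons i l k : is_y_label l k -> is_y_label (i :: l) k.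
Proof. by rewrite /is_y_label /= => ->; rewrite orbT. Qed.

Variables (u0 : 'rV[R]_m) (r : R).
Let B := ball u0 r.

(** Balls for the sup norm are boxes, so coordinates may be exchanged
    between two points without leaving the ball. *)
Lemma ball_mix (u u' v : 'rV[R]_m) : B u -> B u' ->
  (forall k, v 0 k = u 0 k \/ v 0 k = u' 0 k) -> B v.
Proof.
move=> [r0 hu] [_ hu'] huv; split=> // i k; rewrite ord1.
by case: (huv k) => ->; [exact: hu|exact: hu'].
Qed.

Lemma ball_segment (u v : 'rV[R]_m) (t : R) : 0 <= t <= 1 -> B u -> B (u + v) ->
  B (u + t *: v).
Proof.
move=> /andP[t0 t1] [r0 hu] [_ hv]; split=> // i k.
move: (hu i k) (hv i k); rewrite /ball /= !mxE.
set x := u0 i k; set y := u i k; set z := v i k => h1 h2.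
rewrite (_ : x - (y + t * z) = (1 - t) * (x - y) + t * (x - (y + z))); last by ring.
apply: le_lt_trans (ler_normD _ _) _; rewrite !normrM (ger0_norm t0) ger0_norm ?subr_ge0//.
by move: h1 h2; set X := `|_|; set Y := `|_|; have [XY|YX] := leP X Y; nra.
Qed.

Variable F : 'rV[R]_m -> M.
Hypothesis dF : forall u, B u -> differentiable F u.
Hypothesis CF : Ck n B F.
Hypothesis CR : forall u, B u -> forall i a, (a < s i)%N ->
  'd F u (delta_mx 0 (lab i a)) = nuM (nu ^+ a) ('d F u (delta_mx 0 (lab i 0%N))).

Local Notation lx := (fun i => lab i 0%N).

Lemma open_B : open B.
Proof. exact: ball_open. Qed.

(** The Cauchy-Riemann equations identify a displacement in the y-variables
    of block [i] with a displacement of x_i by an element of R[nu]. *)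
Lemma diff_y_block u v i : B u ->
  'd F u (y_blocks [:: i] v) = nuM (nu_y v i) (partial (lx i) F u).
Proof.
move=> Bu; rewrite y_blocks1 linear_sum /= /nu_y act_suml; apply: eq_big_nat => a /andP[_ ha].
by rewrite linearZ /= CR// /partial deriveE ?actZl//; exact: dF.
Qed.

(** Descending induction on [a]: the derivative in t of nu^a F (u + t y), where
    y is the displacement of block [i], is [nu_y_quo v i] times
    nu^(a+1) d_i F (u + t y).  The latter is known from the formula for
    nu^(a+1) F, differentiated in the direction x_i.  The two sides then have the
    same derivative in t, and they agree at t = 0. *)
Lemma taylor_block i v a u : B u -> B (u + y_blocks [:: i] v) ->
  nuM (nu ^+ a) (F (u + y_blocks [:: i] v)) =
  \sum_(k < n.+1) nuM (k`!%:R^-1 *: (nu ^+ a * nu_y v i ^+ k)) (partials (nseq k (lx i)) F u).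
Proof.
have [e ae] : exists e, (n.+1 <= a + e)%N by exists n.+1; rewrite leq_addl.
elim: e => [|e IH] in a ae u v *.
  move=> _ _; rewrite qXn_eq0 ?act0l; last by rewrite addn0 in ae.
  by rewrite big1// => k _; rewrite mul0r scaler0 act0l.
move=> Bu Buv; set y := y_blocks [:: i] v.
have ylZ t : y_blocks [:: i] (t *: v) = t *: y.
  by apply/rowP => k; rewrite !mxE; case: ifP; rewrite ?mulr0.
pose c k := nuM (k`!%:R^-1 *: (nu ^+ a * nu_y v i ^+ k)) (partials (nseq k (lx i)) F u).
pose phi (t : R) := nuM (nu ^+ a) (F (u + t *: y)) - \sum_(k < n.+1) t ^+ k *: c k.
suff : phi 1 = phi 0.
  rewrite /phi scale1r scale0r addr0 => /eqP; rewrite subr_eq => /eqP ->.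
  rewrite [X in _ - X + _]big_ord_recl big1 ?addr0.
    rewrite expr0 scale1r /c /= expr0 mulr1 fact0 invr1 scale1r subrr add0r.
    by apply: eq_bigr => k _; rewrite expr1n scale1r.
  by move=> k _; rewrite /= exprS mul0r scale0r.
apply: derive0_segment => // t t01.
have Bt : B (u + t *: y) by exact: ball_segment.
pose A := [set w | B w /\ B (w + t *: y)].
have oA : open A.
  apply: openI; first exact: open_B.
  exact: open_translate open_B.
have Au : A u by [].
(* The formula for nu^(a+1) F holds near u for the displacement t y, hence can
   be differentiated along x_i; the terms beyond the regularity of F carry
   nu^(a+1+k) with k >= n. *)
have key : nuM (nu ^+ a.+1) (partial (lx i) F (u + t *: y)) =
    \sum_(k < n.+1) nuM (k`!%:R^-1 *: (nu ^+ a.+1 * (t *: nu_y v i) ^+ k))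
       (partials (nseq k.+1 (lx i)) F u).
  have := @partials_act_sum _ _ _ nuM m [:: lx i] A 'I_n.+1 (index_enum _) xpredT
    (fun k : 'I_n.+1 => k`!%:R^-1 *: (nu ^+ a.+1 * (t *: nu_y v i) ^+ k))
    (fun k : 'I_n.+1 => partials (nseq k (lx i)) F) oA.
  move=> <- //; last first.
    move=> k _; have [kn|nk] := ltnP k n; [right|left].
      apply: (@Ck_partials _ _ _ _ _ _ _ n); first by rewrite size_nseq addn1.
      by apply: Ck_sub CF => w [].
    rewrite nu_y_factor exprZn exprMn -scalerAr mulrA -exprD qXn_eq0 ?mul0r ?scaler0//.
    lia.
  have dFt : differentiable (fun w => F (w + t *: y)) u.
    apply: (@differentiable_comp _ _ _ _ (fun w => w + t *: y) F); last exact: dF.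
    by apply: differentiableD => //; exact: differentiable_cst.
  rewrite /= {1}/partial -(@derive_precomp _ _ _ _ idfun).
  rewrite -(@derive_linear _ _ _ _ (@act_cont _ _ _ nuM (nu ^+ a.+1)))//.
  apply: near_eq_derive; apply: filterS (open_nbhs_nbhs (conj oA Au)) => w [Bw Bwt].
  rewrite /=; have := IH a.+1 _ w (t *: v); rewrite ylZ nu_yZ => -> //; lia.
have dphi := @is_derive_line _ _ _ F u y t (dF Bt).
have {}dphi : is_derive t 1 (nuM (nu ^+ a) \o (fun t => F (u + t *: y)))
    (nuM (nu ^+ a) ('d F (u + t *: y) y)).
  have [/derivable1_diffP dl <-] := dphi.
  rewrite -(@derive_linear _ _ _ _ (@act_cont _ _ _ nuM (nu ^+ a)))//.
  apply: derivableP; apply/derivable1_diffP/differentiable_comp => //.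
  exact/linear_differentiable/act_cont.
apply: is_derive_eq; first exact: (is_deriveB dphi (is_derive_vpoly n.+1 c t)).
apply/eqP; rewrite subr_eq0; apply/eqP.
rewrite diff_y_block// actA nu_y_factor mulrA -exprSr mulrC -actA key.
rewrite linear_sum big_ord_recr [RHS]big_ord_recl /= mul0r scale0r add0r.
rewrite [X in _ + X = _](_ : _ = 0) ?addr0.
  apply: eq_bigr => k _; rewrite /c /bump /= add1n actA -!actZl; congr (nuM _ _).
  rewrite exprZn -!scalerAr !scalerA mulrCA !mulrA factS natrM invfM.
  have k0 : k.+1%:R != 0 :> R by rewrite pnatr_eq0.
  rewrite add0n [X in _ = X *: _]mulrACA divff// mul1r [t ^+ k * _]mulrC; congr (_ *: _).
  by rewrite [nu_y v i ^+ k.+1]exprS {2}nu_y_factor !mulrA -exprSr.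
rewrite actA exprZn -!scalerAr nu_y_factor exprMn [nu ^+ a.+1 * _]mulrA -exprD.
by rewrite qXn_eq0 ?mul0r ?mulr0 ?scaler0 ?act0l//; lia.
Qed.

Definition supported (l : seq 'I_D) (al : {ffun 'I_D -> 'I_n.+1}) : bool :=
  [forall i, (i \notin l) ==> (al i == ord0)].

(** Each factor [w i] brings a factor nu, so the monomials of degree > n
    vanish. *)
Lemma prod_nu_y (w w' : 'I_D -> Rn) (al : {ffun 'I_D -> 'I_n.+1}) :
  (forall i, w i = nu * w' i) ->
  \prod_i w i ^+ al i = nu ^+ (\sum_i al i)%N * \prod_i w' i ^+ al i.
Proof.
move=> ww; rewrite -prodrXr -big_split; apply: eq_bigr => i _ /=.
by rewrite ww exprMn.
Qed.

Lemma size_index_seq_supported l al : uniq l -> supported l al ->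
  size (index_seq al l) = (\sum_i al i)%N.
Proof.
move=> ul /forallP sal; rewrite size_index_seq [RHS](bigID (mem l)) /= [X in (_ + X)%N]big1 ?addn0.
  by rewrite big_uniq.
by move=> i il; have := sal i; rewrite il => /eqP ->.
Qed.

Definition set_index (i : 'I_D) (k : 'I_n.+1) (al : {ffun 'I_D -> 'I_n.+1}) :
  {ffun 'I_D -> 'I_n.+1} := [ffun j => if j == i then k else al j].

(** Multi-indices supported on [i :: l] are pairs made of the exponent of
    [i] and of a multi-index supported on [l]. *)
Lemma big_supported_cons (i : 'I_D) (l : seq 'I_D) (f : {ffun 'I_D -> 'I_n.+1} -> M) :
  i \notin l ->
  \sum_(al | supported (i :: l) al) f al =
  \sum_(k < n.+1) \sum_(al | supported l al) f (set_index i k al).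
Proof.
move=> il; rewrite (partition_big (fun al : {ffun _ -> _} => al i) predT)//=.
apply: eq_bigr => k _.
rewrite (reindex_onto (set_index i k) (set_index i ord0)) /=; last first.
  move=> al /andP[_ /eqP alk]; apply/ffunP => j; rewrite !ffunE.
  by case: eqP => // ->.
apply: eq_bigl => al; rewrite ffunE eqxx eqxx andbT.
apply/andP/idP => [[/forallP sal /eqP alE]|/forallP sal].
  apply/forallP => j; apply/implyP => jl; have := sal j.
  rewrite inE negb_or ffunE jl; case: eqVneq => //= -> _.
  by move/ffunP/(_ i): alE; rewrite ffunE eqxx => <-.
split.
  apply/forallP => j; apply/implyP; rewrite inE negb_or ffunE => /andP[/negPf -> jl].
  by have := sal j; rewrite jl.
apply/eqP/ffunP => j; rewrite !ffunE; case: eqP => // ->.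
by have := sal i; rewrite il => /eqP ->.
Qed.

Lemma index_seq_set i k (al : {ffun 'I_D -> 'I_n.+1}) l : i \notin l ->
  index_seq (set_index i k al) l = index_seq al l.
Proof.
move=> il; rewrite /index_seq; congr flatten; apply/eq_in_map => j jl; rewrite ffunE.
by case: eqP => // ji; rewrite -ji jl in il.
Qed.

Lemma big_set_index (T : Type) (idx : T) (op : Monoid.com_law idx) (i : 'I_D)
   k (al : {ffun 'I_D -> 'I_n.+1}) (f : 'I_D -> 'I_n.+1 -> T) :
  f i (al i) = idx ->
  \big[op/idx]_j f j (set_index i k al j) = op (f i k) (\big[op/idx]_j f j (al j)).
Proof.
move=> fi; rewrite (bigD1 i)//= [in RHS](bigD1 i)//= fi Monoid.mul1m ffunE eqxx.
by congr (op _ _); apply: eq_bigr => j /negPf ji; rewrite ffunE ji.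
Qed.

(** The head block is moved last: [taylor_block] is applied at the point
    where the other blocks have already been moved, and the formula for these
    is differentiated along x_i.  Hence the derivative along the head comes out
    as the outermost one, the order used by [mpartial]. *)
Lemma taylor_blocks l a v u : uniq l -> B u -> B (u + y_blocks l v) ->
  nuM (nu ^+ a) (F (u + y_blocks l v)) =
  \sum_(al | supported l al)
    nuM ((\prod_i (al i)`!)%:R^-1 *: (nu ^+ a * \prod_i nu_y v i ^+ al i))
      (partials (map lx (index_seq al l)) F u).
Proof.
elim: l => [|i l IH] in a u *.
  move=> _ _ _; rewrite (big_pred1 [ffun=> ord0]) /=; last first.
    move=> al; apply/forallP/eqP => [sal|-> i]; last by rewrite ffunE.
    by apply/ffunP => i; rewrite ffunE; apply/eqP; exact: (sal i).
  rewrite [X in X%:R^-1]big1; last by move=> i _; rewrite ffunE.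
  rewrite big1; last by move=> i _; rewrite ffunE.
  rewrite invr1 scale1r mulr1 (_ : y_blocks [::] v = 0) ?addr0//.
  by apply/rowP => k; rewrite !mxE.
move=> uil Bu Buv; have /= /andP[il ul] := uil.
have Bul w : B w -> B (w + y_blocks (i :: l) v) -> B (w + y_blocks l v).
  move=> Bw Bwv; apply: ball_mix Bw Bwv _ => k; rewrite !mxE.
  case: ifPn => [/(is_y_label_cons i) ->|_]; [by right|left; exact: addr0].
have yE := y_blocks_cons v uil.
rewrite yE addrA taylor_block; [|exact: Bul|by rewrite -addrA -yE].
rewrite big_supported_cons//; apply: eq_bigr => k _.
pose A := [set w | B w /\ B (w + y_blocks (i :: l) v)].
have oA : open A by apply: openI; [exact: open_B|exact: open_translate open_B].
have -> : k`!%:R^-1 *: (nu ^+ a * nu_y v i ^+ k) =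
    (k`!%:R^-1 *: nu_y_quo v i ^+ k) * nu ^+ (a + k).
  rewrite nu_y_factor exprMn exprD -scalerAl; congr (_ *: _).
  by rewrite mulrA mulrC.
rewrite -actA.
have -> : nuM (nu ^+ (a + k)) (partials (nseq k (lx i)) F (u + y_blocks l v)) =
   \sum_(al | supported l al)
    nuM ((\prod_i (al i)`!)%:R^-1 *: (nu ^+ (a + k) * \prod_i nu_y v i ^+ al i))
      (partials (nseq k (lx i) ++ map lx (index_seq al l)) F u).
  have CkA : Ck (size (nseq k (lx i))) A (fun w => F (w + y_blocks l v)).
    rewrite size_nseq.
    have := @Ck_precomp _ _ _ _ idfun (y_blocks l v) n B F open_B CF.
    move/(@Ck_le _ _ _ k n _ _ (leq_ord k)); apply: Ck_sub => w [Bw Bwv] /=.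
    exact: Bul.
  have := @partials_act_sum _ _ _ nuM m (nseq k (lx i)) A unit [:: tt] xpredT
    (fun=> nu ^+ (a + k)) (fun=> fun w => F (w + y_blocks l v)) oA
    (fun _ _ => or_intror CkA) u (conj Bu Buv).
  rewrite big_seq1 (@partials_precomp _ _ _ _ idfun id)// map_id => <-.
  under eq_bigr do rewrite partials_cat.
  rewrite -(@partials_act_sum _ _ _ nuM m (nseq k (lx i)) A _ _ _ _ _ oA) //.
    apply: partials_eq oA _ _ _ => // w [Bw Bwv]; rewrite big_seq1.
    by apply: IH => //; exact: Bul.
  move=> al sal; have [kn|nk] := leqP (k + \sum_i al i)%N n; [right|left].
    apply: (@Ck_partials _ _ _ _ _ _ _ n); last by apply: Ck_sub CF => w [].
    by rewrite size_nseq size_map size_index_seq_supported// addnC.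
  rewrite (@prod_nu_y _ (nu_y_quo v)) 1?mulrA -?exprD; last by move=> j; exact: nu_y_factor.
  by rewrite qXn_eq0 ?mul0r ?scaler0// -addnA; apply: leq_trans nk (leq_addl _ _).
rewrite linear_sum; apply: eq_bigr => al sal.
have ali : al i = ord0 by have /forallP/(_ i) := sal; rewrite il => /eqP.
rewrite /= actA; congr (nuM _ _).
  rewrite (@big_set_index _ _ _ i k al (fun j (x : 'I_n.+1) => x`!)) ?ali//.
  rewrite (@big_set_index _ _ _ i k al (fun j (x : 'I_n.+1) => nu_y v j ^+ x)) ?ali//.
  rewrite -scalerAl -scalerAr scalerA natrM invfM nu_y_factor exprMn exprD.
  congr (_ *: _).
  rewrite /= -[nu ^+ a * nu ^+ k * _]mulrA mulrCA; congr (_ * _).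
  by rewrite mulrA; congr (_ * _); exact: mulrC.
rewrite (_ : index_seq (set_index i k al) (i :: l) =
  nseq (set_index i k al i) i ++ index_seq (set_index i k al) l)//.
by rewrite map_cat index_seq_set// ffunE eqxx map_nseq.
Qed.

End TaylorFormula.

(** * Extrapolation and the trace on the quotient *)

(** The Vandermonde matrix of distinct nodes is invertible, so evaluation at
    [sigma] of polynomials of degree < n is a combination of evaluations at
    nodes as close as wanted to [tau0]. *)
Lemma extrapolation (R : realType) n (tau0 eps sigma : R) : 0 < eps ->
  exists (tau c : 'I_n -> R), (forall j, `|tau j - tau0| < eps) /\
    forall k, (k < n)%N -> \sum_j c j * tau j ^+ k = sigma ^+ k.
Proof.
(* The nodes tau0 + eps / (2 (j + 1)) are distinct and within eps of tau0. *)
move=> e0; pose tau (j : 'I_n) : R := tau0 + eps * (j.+1%:R^-1 / 2).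
have tau_inj i j : tau i = tau j -> i = j.
  have h2 : (2^-1 : R) != 0 by rewrite invr_neq0// pnatr_eq0.
  move=> /addrI /(mulfI (lt0r_neq0 e0)) /(mulIf h2) /invr_inj /eqP.
  by rewrite eqr_nat eqSS => /eqP/val_inj.
pose V := Vandermonde n (\row_j tau j).
have Vu : V \in unitmx.
  rewrite unitmxE det_Vandermonde unitfE; apply/prodf_neq0 => i _.
  apply/prodf_neq0 => j ij; rewrite !mxE subr_eq0; apply: contraTneq ij => /tau_inj ->.
  by rewrite ltnn.
pose c := invmx V *m \col_k sigma ^+ k.
exists tau, (fun j => c j 0); split=> [j|k kn].
  rewrite /tau addrC addKr normrM gtr0_norm// -ltr_pdivlMl// mulVf ?lt0r_neq0//.
  rewrite ger0_norm; last by rewrite divr_ge0// invr_ge0.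
  rewrite ltr_pdivrMr// mul1r.
  by apply: (@le_lt_trans _ _ 1); rewrite ?ltr1n// invf_le1 ?ler1n// ltr0n.
have : V *m c = \col_k sigma ^+ k by rewrite /c mulmxA mulmxV// mul1mx.
move/matrixP/(_ (Ordinal kn) 0); rewrite !mxE => <-.
by apply: eq_bigr => j _; rewrite !mxE mulrC.
Qed.

Lemma extrapolate (R : realType) (M : normedModType R) n (tau c : 'I_n -> R) sigma (q : 'I_n -> M) :
  (forall k, (k < n)%N -> \sum_j c j * tau j ^+ k = sigma ^+ k) ->
  \sum_j c j *: (\sum_(k < n) tau j ^+ k *: q k) = \sum_(k < n) sigma ^+ k *: q k.
Proof.
move=> h; under eq_bigr do rewrite scaler_sumr; rewrite exchange_big /=.
apply: eq_bigr => k _; rewrite -h// scaler_suml.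
by apply: eq_bigr => j _; rewrite scalerA.
Qed.

Section Taylor.
Variables (R : realType) (m D n : nat) (s : 'I_D -> nat) (lab : 'I_D -> nat -> 'I_m).
Variables (M : normedModType R) (nuM : nu_module n.+1 M).
Local Notation Rn := (Rnu R n.+1).
Local Notation nu := ('qX : Rn).
Local Notation lx := (fun i => lab i 0%N).
Local Notation nu_y := (nu_y n s lab).

(** The value that the Taylor formula predicts when x is moved by the
    nilpotent displacement [w]. *)
Definition taylor (F : 'rV[R]_m -> M) (w : 'I_D -> Rn) (u : 'rV[R]_m) : M :=
  \sum_(al : {ffun 'I_D -> 'I_n.+1} | (\sum_i al i < n.+1)%N)
    ((\prod_i (al i)`!)%:R : R)^-1 *:
      nuM (\prod_i w i ^+ al i) (partials (map lx (index_seq al (enum 'I_D))) F u).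

(** Each monomial in [tau *: w + w'] is the value at [tau] of a polynomial
    over R[nu] of degree at most n. *)
Lemma taylor_poly F (w w' : 'I_D -> Rn) u : exists q : 'I_n.+1 -> M,
  forall tau, taylor F (fun i => tau *: w i + w' i) u = \sum_(k < n.+1) tau ^+ k *: q k.
Proof.
pose P (al : {ffun 'I_D -> 'I_n.+1}) : {poly Rn} :=
  \prod_i ((w i)%:P * 'X + (w' i)%:P) ^+ al i.
have sP (al : {ffun 'I_D -> 'I_n.+1}) : (\sum_i al i < n.+1)%N -> (size (P al) <= n.+1)%N.
  move=> saln; apply: leq_trans saln.
  rewrite /P; elim/big_ind2: _ => [|x p y q sx sy|i _]; first by rewrite size_poly1.
    apply: leq_trans (size_polyMleq _ _) _; move: sx sy; rewrite -ltnS; lia.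
  apply: leq_trans (size_poly_exp_leq _ _) _; rewrite ltnS.
  apply: leq_trans (leq_mul (_ : _ <= 1)%N (leqnn _)) _; last by rewrite mul1n.
  have sq : (size ((w i)%:P * 'X + (w' i)%:P)%R <= 2)%N.
    rewrite (leq_trans (size_polyD _ _))// geq_max (leq_trans (size_polyC_leq1 _))// andbT.
    by rewrite (leq_trans (size_polyMleq _ _))// size_polyX addn2 /= ltnS size_polyC_leq1.
  by move: sq; case: (size _).
exists (fun k => \sum_(al : {ffun 'I_D -> 'I_n.+1} | (\sum_i al i < n.+1)%N)
    ((\prod_i (al i)`!)%:R : R)^-1 *:
      nuM (P al)`_k (partials (map lx (index_seq al (enum 'I_D))) F u)) => tau.
under [RHS]eq_bigr do rewrite scaler_sumr; rewrite exchange_big /=.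
apply: eq_bigr => al aln; under [RHS]eq_bigr do rewrite scalerA mulrC -scalerA.
rewrite -scaler_sumr; congr (_ *: _).
have -> : \prod_i (tau *: w i + w' i) ^+ al i = (P al).[tau%:A].
  rewrite /P horner_prod; apply: eq_bigr => i _.
  by rewrite horner_exp !hornerE mulr_algr.
rewrite (horner_coef_wide _ (sP al aln)) act_suml; apply: eq_bigr => k _.
by rewrite -actZl exprZn expr1n mulr_algr.
Qed.

Hypothesis lab_inj : forall i j a b, (a < s i)%N -> (b < s j)%N ->
  lab i a = lab j b -> i = j /\ a = b.
Hypothesis lab_surj : forall k, exists i a, (a < s i)%N /\ k = lab i a.
Hypothesis s_pos : forall i, (0 < s i)%N.
Implicit Types (u v w : 'rV[R]_m) (x : 'rV[R]_D).

Definition x_part (u : 'rV[R]_m) : 'rV[R]_D := \row_i u 0 (lx i).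

Definition x_incl_mx : 'M[R]_(D, m) := \matrix_(i, k) (k == lx i)%:R.

Local Notation x_incl := (mulmxr x_incl_mx : 'rV[R]_D -> 'rV[R]_m).

Lemma x_incl_delta i : x_incl (delta_mx 0 i) = delta_mx 0 (lx i).
Proof.
by rewrite /= -rowE; apply/rowP => k; rewrite !mxE eqxx.
Qed.

Lemma x_inclE x i : x_incl x 0 (lx i) = x 0 i.
Proof.
rewrite /= !mxE (bigD1 i)//= mxE eqxx mulr1 big1 ?addr0// => j ji.
rewrite mxE; case: eqP => [/(lab_inj (s_pos i) (s_pos j))[ij]|_]; rewrite ?mulr0//.
by rewrite ij eqxx in ji.
Qed.

Definition y_part (u : 'rV[R]_m) : 'rV[R]_m := y_blocks s lab (enum 'I_D) u.

Lemma is_y_label_x i : is_y_label s lab (enum 'I_D) (lx i) = false.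
Proof.
apply/negbTE/hasPn => j _; apply/mapP => -[a]; rewrite mem_index_iota => /andP[a0 a1].
by move=> /(lab_inj (s_pos i) a1)[_ a0']; rewrite -a0' in a0.
Qed.

Lemma is_y_labelT i a : (0 < a < s i)%N -> is_y_label s lab (enum 'I_D) (lab i a).
Proof.
move=> ia; apply/hasP; exists i; first by rewrite mem_enum.
by apply: map_f; rewrite mem_index_iota.
Qed.

Lemma y_partE u i a : (a < s i)%N -> y_part u 0 (lab i a) = if a == 0%N then 0 else u 0 (lab i a).
Proof.
move=> ai; rewrite mxE; case: eqP => [->|/eqP a0]; first by rewrite is_y_label_x.
by rewrite is_y_labelT// lt0n a0.
Qed.

Lemma x_incl_y x i a : (0 < a < s i)%N -> x_incl x 0 (lab i a) = 0.
Proof.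
move=> /andP[a0 ai]; rewrite /= !mxE big1// => j _; rewrite mxE; case: eqP; rewrite ?mulr0//.
by move=> /(lab_inj ai (s_pos j))[_ a0']; rewrite a0' in a0.
Qed.

Lemma row_lab_ext (u v : 'rV[R]_m) :
  (forall i a, (a < s i)%N -> u 0 (lab i a) = v 0 (lab i a)) -> u = v.
Proof. by move=> h; apply/rowP => k; have [i [a [ai ->]]] := lab_surj k; exact: h. Qed.

Lemma x_incl_y_part u : u = x_incl (x_part u) + y_part u.
Proof.
apply: row_lab_ext => i [|a] ai; rewrite mxE y_partE//=.
  by rewrite -[mulmx _ _]/(x_incl _) x_inclE mxE addr0.
by rewrite -[mulmx _ _]/(x_incl _) x_incl_y// add0r.
Qed.

Lemma x_part_incl x u : x_part (x_incl x + y_part u) = x.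
Proof. by apply/rowP => i; rewrite !mxE is_y_label_x addr0 -[RHS](x_inclE x) /= mxE. Qed.

Lemma nu_y_y_part u i : nu_y (y_part u) i = nu_y u i.
Proof. by apply: eq_big_nat => -[//|a] /andP[_ ha]; rewrite y_partE. Qed.

Lemma nu_yD u v i : nu_y (u + v) i = nu_y u i + nu_y v i.
Proof. by rewrite -[u]scale1r nu_y_linear !scale1r. Qed.

Lemma y_part_id v : x_part v = 0 -> y_part v = v.
Proof. by move=> pv; rewrite [RHS]x_incl_y_part pv linear0 add0r. Qed.

Section LocalFormula.
Variables (O : set 'rV[R]_m) (F : 'rV[R]_m -> M).
Hypothesis oO : open O.
Hypothesis dF : forall u, O u -> differentiable F u.
Hypothesis CF : Ck n O F.
Hypothesis CR : forall u, O u -> forall i a, (a < s i)%N ->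
  'd F u (delta_mx 0 (lab i a)) = nuM (nu ^+ a) ('d F u (delta_mx 0 (lab i 0%N))).

(** [taylor_blocks] for the list of all blocks; the multi-indices of weight
    > n contribute nothing. *)
Lemma taylor_ball u0 r u v : ball u0 r `<=` O -> ball u0 r u -> ball u0 r (u + v) ->
  x_part v = 0 -> F (u + v) = taylor F (nu_y v) u.
Proof.
move=> BO Bu Bv pv; have dFB w : ball u0 r w -> differentiable F w by move/BO/dF.
have CRB w : ball u0 r w -> forall i a, (a < s i)%N ->
  'd F w (delta_mx 0 (lab i a)) = nuM (nu ^+ a) ('d F w (delta_mx 0 (lab i 0%N))).
  by move/BO/CR.
have vE : y_blocks s lab (enum 'I_D) v = v by exact: y_part_id.
have := @taylor_blocks _ _ _ _ _ _ _ nuM lab_inj u0 r F dFB (Ck_sub BO CF) CRB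
  (enum 'I_D) 0%N v u (enum_uniq _) Bu; rewrite vE => /(_ Bv).
rewrite expr0 act1 => ->; rewrite /taylor [RHS]big_mkcond [LHS]big_mkcond.
apply: eq_bigr => al _; rewrite ifT; last by apply/forallP => i; rewrite mem_enum.
rewrite mul1r actZl; case: ifPn => //; rewrite -leqNgt => aln.
rewrite (@prod_nu_y _ _ _ _ (nu_y_quo n s lab v)); last by move=> i; exact: nu_y_factor.
by rewrite qXn_eq0 ?mul0r ?act0l ?scaler0.
Qed.

Lemma taylor0 u : O u -> taylor F (fun=> 0) u = F u.
Proof.
move=> Ou; have [r r0 BO] : exists2 r : R, 0 < r & ball u r `<=` O.
  by have /nbhs_ballP[r r0 BO] := open_nbhs_nbhs (conj oO Ou); exists r.
have Bu : ball u r u by exact: ballxx.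
rewrite -[in RHS](addr0 u) (taylor_ball BO)// ?addr0//.
  by congr taylor; apply/funext => i; rewrite nu_y0.
by apply/rowP => i; rewrite !mxE.
Qed.

(** The value at y = 0 extrapolated from [u] by the Taylor formula. *)
Definition centre (u : 'rV[R]_m) : M := taylor F (fun i => - nu_y u i) u.

Lemma rescale_ball u0 (r : R) : 0 < r -> exists2 eps : R, 0 < eps &
  forall u (t : R), ball u0 (r / 2) u -> `|t| < eps -> ball u0 r (u + t *: y_part u).
Proof.
move=> r0; pose K := `|u0| + r.
have K0 : 0 < K by apply: ltr_wpDl.
exists (r / 2 / K) => [|u t [r20 hu] te]; first by rewrite !divr_gt0.
split=> // i k; move: (hu i k); rewrite ord1 /ball /= !mxE => huk.
have u0k : `|u0 0 k| <= `|u0|.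
  rewrite [leRHS]/Num.Def.normr /= mx_normrE.
  exact: (@le_bigmax _ _ _ 0 (fun ij : 'I_1 * 'I_m => `|u0 ij.1 ij.2|) (0, k)).
have uk : `|u 0 k| <= K.
  rewrite (_ : u 0 k = u0 0 k - (u0 0 k - u 0 k)); last by ring.
  by apply: le_trans (ler_normB _ _) _; apply: lerD => //; lra.
have tu : `|t * (if is_y_label s lab (enum 'I_D) k then u 0 k else 0)| < r / 2.
  rewrite normrM; apply: (@le_lt_trans _ _ (`|t| * K)).
    by rewrite ler_wpM2l//; case: ifP => // _; rewrite normr0 ltW.
  by rewrite -ltr_pdivlMr.
rewrite opprD addrA; apply: le_lt_trans (ler_normB _ _) _.
by rewrite (splitr r) ltrD.
Qed.

(** On the ray [u' + (tau - 1) *: y_part u'] the function is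
    polynomial in [tau] and its value at [tau = 0] is predicted from any nearby
    point with the same x: this gives the third clause.  For the last one, the
    Taylor expansion by [nu_y u0] at the point of parameter [tau] equals the
    expansion by [tau *: nu_y u0] at [u0].  That is clear for small multiples of
    [nu_y u0], by the Taylor formula, and follows in general by extrapolation.
    Extrapolating to [tau = 0] then leaves the expansion by zero. *)
Lemma local_formula u0 : O u0 -> exists r : R, exists tau c : 'I_n.+1 -> R,
  [/\ 0 < r, forall u j, ball u0 r u -> O (u + (tau j - 1) *: y_part u),
    forall u u', ball u0 r u -> ball u0 r u' -> x_part u = x_part u' ->
      \sum_j c j *: F (u' + (tau j - 1) *: y_part u') = centre u
  & \sum_j c j *: taylor F (nu_y u0) (u0 + (tau j - 1) *: y_part u0) = F u0].
Proof.
move=> Ou0; have [r r0 BO] : exists2 r : R, 0 < r & ball u0 r `<=` O.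
  by have /nbhs_ballP[r r0 BO] := open_nbhs_nbhs (conj oO Ou0); exists r.
have [eps e0 Beps] := rescale_ball u0 r0.
have [tau [c [taue ctau]]] := @extrapolation R n.+1 1 eps 0 e0.
have sub u : ball u0 (r / 2) u -> ball u0 r u.
  by apply: le_ball; lra.
have r2 : 0 < r / 2 by rewrite divr_gt0.
have x_part_yZ t u : x_part (t *: y_part u) = 0.
  by apply/rowP => i; rewrite !mxE is_y_label_x mulr0.
exists (r / 2), tau, c; split => //.
- by move=> u j Bu; apply: BO; exact: Beps.
- move=> u u' Bu Bu' puu'.
  have [q qP] := taylor_poly F (nu_y u') (fun i => - nu_y u i) u.
  have -> : \sum_j c j *: F (u' + (tau j - 1) *: y_part u') =
      \sum_j c j *: (\sum_(k < n.+1) tau j ^+ k *: q k).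
    apply: eq_bigr => j _; congr (_ *: _); rewrite -qP.
    have -> : u' + (tau j - 1) *: y_part u' = u + (u' - u + (tau j - 1) *: y_part u').
      by rewrite addrA addrCA subrr addr0.
    rewrite (taylor_ball BO)//; first last.
    + apply/rowP => i; move/rowP/(_ i): puu'; rewrite !mxE is_y_label_x => ->.
      by rewrite subrr add0r mulr0.
    + rewrite addrA [u + _]addrC subrK; exact: Beps.
    + exact: sub.
    congr taylor; apply/funext => i.
    rewrite !nu_yD -scaleN1r !nu_yZ nu_y_y_part scaleN1r scalerBl scale1r.
    by rewrite addrC addrA subrK.
  rewrite (extrapolate _ ctau) -qP /centre; congr taylor; apply/funext => i.
  by rewrite scale0r add0r.
- have key j : taylor F (nu_y u0) (u0 + (tau j - 1) *: y_part u0) =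
      taylor F (fun i => tau j *: nu_y u0 i + 0) u0.
    have e'0 : 0 < eps - `|tau j - 1| by rewrite subr_gt0.
    have [del [d [dele ddel]]] := @extrapolation R n.+1 0 _ 1 e'0.
    have [q qP] := taylor_poly F (nu_y u0) (fun=> 0) (u0 + (tau j - 1) *: y_part u0).
    have [q' q'P] := taylor_poly F (nu_y u0) (fun i => (tau j - 1) *: nu_y u0 i) u0.
    transitivity (\sum_(k < n.+1) 1 ^+ k *: q k).
      by rewrite -qP; congr taylor; apply/funext => i; rewrite scale1r addr0.
    transitivity (\sum_(k < n.+1) 1 ^+ k *: q' k); last first.
      rewrite -q'P; congr taylor; apply/funext => i.
      by rewrite -scalerDl addrC subrK addr0.
    rewrite -!(extrapolate _ ddel); apply: eq_bigr => i _; congr (_ *: _).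
    rewrite -qP -q'P.
    have dj : `|del i + (tau j - 1)| < eps.
      apply: le_lt_trans (ler_normD _ _) _; have := dele i; rewrite subr0; lra.
    have uE : u0 + (tau j - 1) *: y_part u0 + del i *: y_part u0 =
        u0 + (del i + (tau j - 1)) *: y_part u0.
      by rewrite -addrA -scalerDl [_ + del i]addrC.
    transitivity (F (u0 + (del i + (tau j - 1)) *: y_part u0)).
      rewrite -uE (taylor_ball BO) ?x_part_yZ//; first last.
      + by rewrite uE; apply: Beps => //; exact: ballxx.
      + by apply: Beps => //; exact: ballxx.
      by congr taylor; apply/funext => l; rewrite nu_yZ nu_y_y_part addr0.
    rewrite (taylor_ball BO) ?x_part_yZ//; first last.
    + by apply: Beps => //; exact: ballxx.
    + exact: ballxx.
    by congr taylor; apply/funext => l; rewrite nu_yZ nu_y_y_part scalerDl.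
  under eq_bigr do rewrite key.
  have [q qP] := taylor_poly F (nu_y u0) (fun=> 0) u0.
  under eq_bigr do rewrite qP.
  rewrite (extrapolate _ ctau) -qP -taylor0//; congr taylor; apply/funext => i.
  by rewrite scale0r add0r.
Qed.

(** By [local_formula] the extrapolated value is locally constant along the
    curve. *)
Lemma centre_path (gam : R -> 'rV[R]_m) :
  (forall t : R, 0 <= t <= 1 ->
    [/\ O (gam t), {for t, continuous gam} & x_part (gam t) = x_part (gam 0)]) ->
  centre (gam 1) = centre (gam 0).
Proof.
move=> hgam; pose phi t := centre (gam t).
have loc (t : R) : 0 <= t <= 1 -> \forall t' \near t, 0 <= t' <= 1 -> phi t' = phi t.
  move=> t01; have [Og cg pg] := hgam t t01.
  have [r [tau [c [r0 _ cst _]]]] := local_formula Og.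
  have Br : nbhs (gam t) (ball (gam t) r) by exact: nbhsx_ballx.
  apply: (@filterS _ (nbhs t) _ (gam @^-1` ball (gam t) r)); last exact: cg _ Br.
  move=> t' Bt' t'01; have [_ _ pg'] := hgam t' t'01.
  have Bt : ball (gam t) r (gam t) by exact: ballxx.
  by rewrite /phi -(cst _ _ Bt' Bt' erefl) (cst _ _ Bt Bt')// pg.
apply: (@derive0_constant _ _ phi 0 1) => //.
  apply/subspace_continuousP => t /=; rewrite in_itv /= => t01.
  have h : \forall t' \near within `[0, 1] (nbhs t), phi t' = phi t.
    rewrite near_withinE; apply: filterS (loc t t01) => t' h /=.
    by rewrite in_itv => /h.
  exact: (@cvg_near_cst R M (phi t) phi (within `[0, 1] (nbhs t)) _ h).
move=> t /andP[t0 t1]; apply: (@near_eq_is_derive _ _ _ (cst (phi t))).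
have t01 : 0 <= t <= 1 by rewrite !ltW.
have nt : \forall t' \near t, 0 <= t' <= 1.
  near=> t'; apply/andP; split; apply: ltW; near: t'.
    exact: lt_nbhsr.
  exact: lt_nbhsl.
by apply: filterS2 nt (loc t t01) => t' t'01 h; rewrite h.
Unshelve. all: by end_near. Qed.

Hypothesis centre_px : forall u u', O u -> O u' -> x_part u = x_part u' ->
  centre u = centre u'.

(** The adapted function of the expansion, as a function of x. *)
Definition x_trace (x : 'rV[R]_D) : M := centre (get [set u | O u /\ x_part u = x]).

Lemma x_traceE u : O u -> x_trace (x_part u) = centre u.
Proof.
move=> Ou; have ex : exists u', [set u' | O u' /\ x_part u' = x_part u] u' by exists u.
by have [Ou' pu'] := getPex ex; exact: centre_px.
Qed.

(** Near a point the trace is a constant combination of functions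
    [F (x + z_j)], which are as regular as [F]. *)
Lemma x_trace_local u0 : O u0 -> exists (A : set 'rV[R]_D) (c : 'I_n.+1 -> R)
    (z : 'I_n.+1 -> 'rV[R]_m),
  [/\ open A, A (x_part u0), forall x j, A x -> O (x_incl x + z j),
    forall x, A x -> x_trace x = \sum_j c j *: F (x_incl x + z j)
  & \sum_j c j *: taylor F (nu_y u0) (x_incl (x_part u0) + z j) = F u0].
Proof.
move=> Ou0; have [r [tau [c [r0 Bt cst exp]]]] := local_formula Ou0.
pose A := [set x | (ball u0 r `&` O) (x_incl x + y_part u0)].
have shiftE x j : x_incl x + y_part u0 + (tau j - 1) *: y_part (x_incl x + y_part u0) =
    x_incl x + tau j *: y_part u0.
  have -> : y_part (x_incl x + y_part u0) = y_part u0.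
    apply: row_lab_ext => i a ai; rewrite y_partE// mxE; case: eqP => [->|/eqP a0].
      by rewrite y_partE.
    by rewrite x_incl_y ?add0r// lt0n a0.
  by rewrite scalerBl scale1r -addrA subrKC.
exists A, c, (fun j => tau j *: y_part u0); split.
- apply: (@open_affine _ _ _ x_incl); apply: openI => //; exact: ball_open.
- by rewrite /A /= -x_incl_y_part; split=> //; exact: ballxx.
- by move=> x j [Bx Ox]; rewrite -shiftE; exact: Bt.
- move=> x [Bx Ox]; rewrite -{1}(x_part_incl x u0) x_traceE//.
  by rewrite -(cst _ _ Bx Bx)//; apply: eq_bigr => j _; rewrite shiftE.
- rewrite -[RHS]exp; apply: eq_bigr => j _; congr (_ *: taylor _ _ _).
  by rewrite -shiftE -x_incl_y_part.
Qed.

Lemma Ck_x_trace : Ck n (x_part @` O) x_trace.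
Proof.
apply/Ck_pointwise => _ [u0 Ou0 <-].
have [A [c [z [oA Au0 AO redE _]]]] := x_trace_local Ou0.
have : Ck n A (fun x => \sum_j c j *: F (x_incl x + z j)).
  apply: Ck_sum => // j _; apply: CkZ => //.
  by apply: Ck_sub (Ck_precomp x_incl (z j) oO CF) => x; exact: AO.
move=> /Ck_eq - /(_ x_trace oA (fun x Ax => esym (redE x Ax))).
by apply: Ck_sub => _ ->.
Qed.

Lemma partials_x_trace (A : set 'rV[R]_D) (c : 'I_n.+1 -> R)
    (z : 'I_n.+1 -> 'rV[R]_m) (js : seq 'I_D) x :
  open A -> A x -> (forall x j, A x -> O (x_incl x + z j)) ->
  (forall x, A x -> x_trace x = \sum_j c j *: F (x_incl x + z j)) ->
  (size js <= n)%N ->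
  partials js x_trace x = \sum_j c j *: partials (map lx js) F (x_incl x + z j).
Proof.
move=> oA Ax AO redE jsn.
have := @partials_act_sum _ _ _ nuM D js A _ (index_enum 'I_n.+1) xpredT (fun j => c j *: 1)
  (fun j x => F (x_incl x + z j)) oA.
move=> /(_ _ x Ax) h.
rewrite (partials_eq js oA (G := fun x => \sum_j nuM (c j *: 1) (F (x_incl x + z j))))//.
  rewrite h.
    by apply: eq_bigr => j _; rewrite act_scalar (partials_precomp _ _ _ _ x_incl_delta).
  move=> j _; right; apply: Ck_le jsn _.
  by apply: Ck_sub (Ck_precomp x_incl (z j) oO CF) => y; exact: AO.
by move=> y Ay; rewrite redE//; apply: eq_bigr => j _; rewrite act_scalar.
Qed.

Lemma x_trace_expansion u : O u ->
  F u = \sum_(al : {ffun 'I_D -> 'I_n.+1} | (\sum_i al i < n.+1)%N)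
    ((\prod_i (al i)`!)%:R : R)^-1 *:
      nuM (\prod_i nu_y u i ^+ al i) (mpartial al x_trace (x_part u)).
Proof.
move=> Ou; have [A [c [z [oA Au0 AO redE <-]]]] := x_trace_local Ou.
rewrite /taylor; under eq_bigr do rewrite scaler_sumr; rewrite exchange_big /=.
apply: eq_bigr => al aln; rewrite mpartialE (partials_x_trace oA Au0 AO redE).
  rewrite linear_sum scaler_sumr; apply: eq_bigr => j _.
  by rewrite /= actZr !scalerA mulrC.
by rewrite size_index_seq big_enum.
Qed.

Lemma differentiable_shift z x : O (x_incl x + z) -> differentiable (fun x => F (x_incl x + z)) x.
Proof.
move=> Ox; apply: (@differentiable_comp _ _ _ _ (fun x => x_incl x + z) F); last exact: dF.
apply: differentiableD; last exact: differentiable_cst.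
exact/linear_differentiable/row_linear_continuous.
Qed.

Lemma differentiable_x_trace u : O u -> differentiable x_trace (x_part u).
Proof.
move=> Ou; have [A [c [z [oA Au0 AO redE _]]]] := x_trace_local Ou.
apply: (@differentiable_near _ _ _ (\sum_j (fun x => c j *: F (x_incl x + z j)))).
  apply: filterS (open_nbhs_nbhs (conj oA Au0)) => x Ax.
  by rewrite redE// fct_sumE.
apply: differentiable_sum => j; apply: differentiableZ.
exact/differentiable_shift/AO.
Qed.

Lemma diff_x_trace_end i u :
  (forall u, O u -> nuM (nu ^+ s i) ('d F u (delta_mx 0 (lx i))) = 0) -> O u ->
  nuM (nu ^+ s i) ('d x_trace (x_part u) (delta_mx 0 i)) = 0.
Proof.
move=> h Ou; have [A [c [z [oA Au0 AO redE _]]]] := x_trace_local Ou.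
rewrite -deriveE; last exact: differentiable_x_trace.
rewrite (@near_eq_derive _ _ _ _ (fun x => \sum_j nuM (c j *: 1) (F (x_incl x + z j)))); last first.
  apply: filterS (open_nbhs_nbhs (conj oA Au0)) => x Ax.
  by rewrite redE//; apply: eq_bigr => j _; rewrite act_scalar.
have dshift j : true -> c j *: (1 : Rn) = 0 \/
    differentiable (fun x => F (x_incl x + z j)) (x_part u).
  by move=> _; right; exact/differentiable_shift/AO.
rewrite (@derive_val _ _ _ _ _ _ _ (is_derive_act_sum nuM _ _ dshift)) linear_sum big1// => j _.
rewrite /= act_scalar actZr (@derive_precomp _ _ _ _ x_incl (z j) F).
rewrite [X in 'D_X _ _](x_incl_delta i) deriveE; last exact/dF/AO.
by rewrite h ?scaler0//; exact: AO.
Qed.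

End LocalFormula.
End Taylor.

(** * From nilomorphic functions to their expansion *)

Section JordanMatrix.
Variables (R : realType) (m D : nat) (s : 'I_D -> nat) (lab : 'I_D -> nat -> 'I_m).
Variable A : 'M[R]_m.
Hypothesis lab_inj : forall i j a b, (a < s i)%N -> (b < s j)%N ->
  lab i a = lab j b -> i = j /\ a = b.
Hypothesis lab_surj : forall k, exists i a, (a < s i)%N /\ k = lab i a.
Hypothesis A_int : forall i a, (a < s i)%N ->
  delta_mx 0 (lab i a) = delta_mx 0 (lab i 0%N) *m A ^+ a :> 'rV[R]_m.
Hypothesis A_end : forall i, delta_mx 0 (lab i 0%N) *m A ^+ s i = 0 :> 'rV[R]_m.

(** In N-integral coordinates, [A] shifts the basis vectors of each
    block. *)
Lemma delta_lab_exp i a b : (b < s i)%N ->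
  delta_mx 0 (lab i b) *m A ^+ a =
  if (b + a < s i)%N then delta_mx 0 (lab i (b + a)) else 0 :> 'rV[R]_m.
Proof.
move=> bi; rewrite A_int// -mulmxA -[A ^+ b *m _]/(A ^+ b * A ^+ a) -exprD.
case: ltnP => [h|h]; first by rewrite -A_int.
by rewrite -(subnKC h) exprD -[_ * _]/(_ *m _) mulmxA A_end mul0mx.
Qed.

Lemma mul_exp_lab (v : 'rV[R]_m) i a b : (a + b < s i)%N ->
  (v *m A ^+ a) 0 (lab i (a + b)) = v 0 (lab i b).
Proof.
move=> ai; have bi : (b < s i)%N by apply: leq_ltn_trans ai; rewrite leq_addl.
rewrite [in LHS](row_sum_delta v) mulmx_suml summxE (bigD1 (lab i b))//=.
rewrite -scalemxAl delta_lab_exp// addnC ai !mxE !eqxx mulr1 big1 ?addr0// => k kb.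
have [j [c [cj kE]]] := lab_surj k.
rewrite -scalemxAl kE delta_lab_exp// !mxE; case: ifPn => [h|_]; rewrite !mxE ?mulr0//=.
case: eqP => [/(lab_inj ai h)[ij bc]|_]; rewrite ?mulr0//.
by move: bc; rewrite addnC => /addIn bc; rewrite kE -ij bc eqxx in kb.
Qed.

Lemma mul_lab0 (v : 'rV[R]_m) i : (0 < s i)%N -> (v *m A) 0 (lab i 0%N) = 0.
Proof.
move=> si; rewrite [in LHS](row_sum_delta v) mulmx_suml summxE big1// => k _.
have [j [c [cj ->]]] := lab_surj k.
rewrite -scalemxAl mxE -[A]expr1 delta_lab_exp//.
case: ifPn => [h|_]; rewrite !mxE ?mulr0//=.
by case: eqP => [/(lab_inj si h)[_]|_]; rewrite ?mulr0 ?addn1.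
Qed.

End JordanMatrix.

Section Charts.
Variables (R : realType) (T : topologicalType) (m : nat) (X : manifold R T m).

Lemma derive_chart_entry (k : nat) (gam : R -> 'rV[R]_k) (t : R) (j : 'I_k) :
  derivable gam t 1 -> is_derive t 1 (fun t => gam t 0 j) ('D_1 gam t 0 j).
Proof.
move=> dg; rewrite derive_mx// mxE; apply: derivableP.
exact: (@derivable_mxP _ _ _ _ gam t 1).1 dg 0 j.
Qed.

Lemma leaf_refl (Delta : distribution R T m) V p : V p -> leaf X Delta V p p.
Proof.
move=> Vp; exists (fun=> p); split=> // t _; split=> //; first exact: cst_continuous.
move=> c _ _; rewrite (_ : _ \o _ = cst (coord c p))//.
by split; [exact: derivable_cst|rewrite derive_cst sub0mx].
Qed.

(** The image of N has no component along the x-directions, so the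
    x-coordinates have zero derivative along the curve. *)
Lemma leaf_ImN_x_part (N : endo_field X) D (s : 'I_D -> nat) (lab : 'I_D -> nat -> 'I_m) c
    (V : set T) (gam : R -> T) :
  (forall i j a b, (a < s i)%N -> (b < s j)%N -> lab i a = lab j b -> i = j /\ a = b) ->
  (forall k, exists i a, (a < s i)%N /\ k = lab i a) ->
  (forall i, (0 < s i)%N) ->
  atlas X c -> V `<=` dom c ->
  (forall p, V p -> forall i a, (a < s i)%N ->
    delta_mx 0 (lab i a) = delta_mx 0 (lab i 0%N) *m N c p ^+ a :> 'rV[R]_m) ->
  (forall p, V p -> forall i,
    delta_mx 0 (lab i 0%N) *m N c p ^+ s i = 0 :> 'rV[R]_m) ->
  (forall t : R, 0 <= t <= 1 -> [/\ V (gam t), {for t, continuous gam} &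
     forall c, atlas X c -> dom c (gam t) ->
       derivable (coord c \o gam) t 1 /\
       ('D_1 (coord c \o gam) t <= ImN N c (gam t))%MS]) ->
  forall t : R, 0 <= t <= 1 -> x_part lab (coord c (gam t)) = x_part lab (coord c (gam 0)).
Proof.
move=> lab_inj lab_surj s_pos ca Vc int iend hgam t /andP[t0 t1]; apply/rowP => i.
rewrite !mxE.
apply: (@derive0_segment _ _ (fun t => coord c (gam t) 0 (lab i 0%N)) 0 t) => // x /andP[x0 xt].
have [|Vx _ dgx] := hgam x; first by rewrite x0 (le_trans xt).
have [dx /submxP[w wE]] := dgx c ca (Vc _ Vx).
apply: is_derive_eq; first exact: (derive_chart_entry (lab i 0%N) dx).
by rewrite wE (@mul_lab0 _ _ _ s lab _ lab_inj lab_surj)//; [exact: int|exact: iend].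
Qed.

End Charts.

Section Forward.
Variables (R : realType) (T : topologicalType) (m : nat) (X : manifold R T m).
Variables (n : nat) (N : endo_field X) (U : set T) (M : normedModType R).
Variables (nuM : nu_module n.+1 M) (f : T -> M).
Hypotheses (hf : Ck_on X n U f) (hnil : nilomorphic N nuM U f).
Variables (D : nat) (s : 'I_D -> nat) (c : chart R T m) (lab : 'I_D -> nat -> 'I_m).
Hypothesis hc : nilomorphic_coordinates N U s c lab.

Local Notation nu := ('qX : Rnu R n.+1).
Let O := coord c @` dom c.
Let F := f \o cinv c.

Let ca : atlas X c := nc_atlas hc.

Let chc : is_chart c := atlas_chart ca.

Lemma nc_lab_inj i j a b : (a < s i)%N -> (b < s j)%N ->
  lab i a = lab j b -> i = j /\ a = b.
Proof.
move=> ai bj e; have [_ + _] := nc_lab hc.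
by move=> /(_ (i, a) (j, b)); rewrite !inE => /(_ ai bj e)[-> ->].
Qed.

Lemma nc_lab_surj k : exists i a, (a < s i)%N /\ k = lab i a.
Proof.
have [_ _ /(_ k Logic.I)[[i a] /= ai <-]] := nc_lab hc.
by exists i, a.
Qed.

Let oO : open O. Proof. by have [] := chc. Qed.

Let cinvK p : dom c p -> cinv c (coord c p) = p. Proof. by have [] := chc; auto. Qed.

Let xcoordE p : xcoord c lab p = x_part lab (coord c p). Proof. by []. Qed.

Let dF u : O u -> differentiable F u.
Proof. by move=> [p cp <-]; apply: hnil.1 => //; exact: (nc_sub hc). Qed.

Let CF : Ck n O F.
Proof.
have := hf ca; apply: Ck_sub => _ [p cp <-]; exists p => //; split=> //.
exact: (nc_sub hc).
Qed.

Lemma nilomorphic_exp p (v : 'rV[R]_m) a : dom c p ->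
  'd F (coord c p) (v *m N c p ^+ a) = nuM (nu ^+ a) ('d F (coord c p) v).
Proof.
move=> cp; elim: a => [|a IH]; first by rewrite !expr0 mulmx1 act1.
rewrite exprSr -[_ * _]/(_ *m _) mulmxA (hnil.2 _ _ ca cp) ?IH ?actA -?exprS//.
exact: (nc_sub hc).
Qed.

Let CR u : O u -> forall i a, (a < s i)%N ->
  'd F u (delta_mx 0 (lab i a)) = nuM (nu ^+ a) ('d F u (delta_mx 0 (lab i 0%N))).
Proof.
by move=> [p cp <-] i a ai; rewrite (nc_integral hc cp)// nilomorphic_exp.
Qed.

Let CRend u i : O u -> nuM (nu ^+ s i) ('d F u (delta_mx 0 (lab i 0%N))) = 0.
Proof.
by move=> [p cp <-]; rewrite -nilomorphic_exp// (nc_end hc cp) linear0.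
Qed.

Let g := x_trace s lab nuM O F.
Local Notation centre := (centre s lab nuM F).

(** Points with the same x lie on a common leaf of Im N, hence are joined by
    a curve along which x is constant. *)
Lemma centre_leaf u u' : O u -> O u' -> x_part lab u = x_part lab u' -> centre u = centre u'.
Proof.
move=> [p cp <-] [q cq <-] pxpq.
have leafE : proj N (dom c) p = proj N (dom c) q by apply/(nc_proj hc).
have [gam [<- <- hgam]] : proj N (dom c) p q by rewrite leafE; exact: leaf_refl.
symmetry.
apply: (@centre_path _ _ _ _ _ _ _ nuM nc_lab_inj nc_lab_surj (nc_pos hc) O F oO dF CF CR
  (fun t => coord c (gam t))) => t t01.
have [Vt cgt dgt] := hgam t t01; split; first by exists (gam t).
  by apply: (continuous_comp cgt); have [_ _ _ +_] := chc; apply.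
exact: (leaf_ImN_x_part nc_lab_inj nc_lab_surj (nc_pos hc) ca (fun _ => id)
  (nc_integral hc) (nc_end hc) hgam).
Qed.

(** The velocity of the curve lies in ker N^a, so its x_i-component vanishes for
    the blocks of size > a; for the other blocks nu^a kills the derivative of the
    trace along x_i. *)
Lemma x_trace_leaf_KerN p q a : leaf X (KerN N a) (dom c) p q ->
  nuM (nu ^+ a) (g (x_part lab (coord c q))) = nuM (nu ^+ a) (g (x_part lab (coord c p))).
Proof.
move=> [gam [<- <- hgam]].
apply: (@derive0_segment _ _
  (fun t => nuM (nu ^+ a) (g (x_part lab (coord c (gam t))))) 0 1) => // t t01.
have [Vt _ /(_ c ca Vt)[dgt /sub_kermxP]] := hgam t t01.
set v := 'D_1 _ t => vN.
have Ot : O (coord c (gam t)) by exists (gam t).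
have dg : differentiable g (x_part lab (coord c (gam t))).
  exact: (differentiable_x_trace nc_lab_inj nc_lab_surj (nc_pos hc) oO dF CF CR centre_leaf).
have dpx : derivable (fun t => x_part lab (coord c (gam t))) t 1.
  apply/derivable_mxP => i j; under eq_fun do rewrite mxE.
  by case: (derive_chart_entry (lab j 0%N) dgt).
have dpx' : differentiable (fun t => x_part lab (coord c (gam t))) t by exact/derivable1_diffP.
have dgpx : differentiable (g \o (fun t => x_part lab (coord c (gam t)))) t.
  by apply: differentiable_comp.
have dagpx : differentiable (nuM (nu ^+ a) \o (g \o (fun t => x_part lab (coord c (gam t))))) t.
  by apply: differentiable_comp => //; exact/linear_differentiable/act_cont.
apply: DeriveDef; first exact/derivable1_diffP.
rewrite derive_linear//; last exact: act_cont.
rewrite deriveE// diff_comp//= -[X in 'd g _ X]deriveE//.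
rewrite [X in 'd g _ X]row_sum_delta !linear_sum big1// => i _.
rewrite !linearZ/=.
have [ai|ai] := ltnP a (s i).
  have := @mul_exp_lab _ _ _ s lab _ nc_lab_inj nc_lab_surj (nc_integral hc Vt) (nc_end hc Vt)
    v i a 0%N.
  rewrite addn0 vN mxE => /(_ ai) v0.
  rewrite derive_mx// mxE (_ : 'D_1 _ t = 0) ?scale0r ?linear0//.
  have [_ ] := derive_chart_entry (lab i 0%N) dgt; rewrite -/v -v0 => <-.
  by congr ('D_1 _ t); apply/funext => x; rewrite mxE.
rewrite -(subnK ai) exprD -actA.
rewrite (diff_x_trace_end nc_lab_inj nc_lab_surj (nc_pos hc) oO dF CF CR centre_leaf)//.
  by rewrite linear0 scaler0.
by move=> u; exact: CRend.
Qed.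

Lemma nilomorphic_expansion : exists (fc : set T -> M) (g : 'rV[R]_D -> M),
       [/\ adapted N nuM (dom c) fc,
           forall p, dom c p -> g (xcoord c lab p) = fc (proj N (dom c) p),
           Ck n (xcoord c lab @` dom c) g
         & forall p, dom c p -> f p = nilo_expansion s c lab nuM g p].
Proof.
pose rep (A : set T) : set T := [set p | dom c p /\ proj N (dom c) p = A].
pose fc A : M := if pselect (exists p, rep A p) is left e then
   g (xcoord c lab (projT1 (cid e))) else 0.
have fcE p : dom c p -> g (xcoord c lab p) = fc (proj N (dom c) p).
  move=> cp; rewrite /fc; case: pselect => [e|[]]; last by exists p.
  by case: (cid e) => q /= [cq qp]; congr g; apply/(nc_proj hc).
exists fc, g; split => //.
- move=> a p an cp _ _ [q lq <-] [q' lq' <-].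
  have dq r : leaf X (KerN N a) (dom c) p r -> dom c r.
    by move=> [gam [_ <- /(_ 1)]]; rewrite ler01 lexx => -[].
  by rewrite -!fcE ?xcoordE; [rewrite !(@x_trace_leaf_KerN p)|exact: dq|exact: dq].
- have := Ck_x_trace nc_lab_inj nc_lab_surj (nc_pos hc) oO dF CF CR centre_leaf.
  by apply: Ck_sub => _ [p cp <-]; exists (coord c p) => //; exists p.
- move=> p cp; have Op : O (coord c p) by exists p.
  have := x_trace_expansion nc_lab_inj nc_lab_surj (nc_pos hc) oO dF CF CR centre_leaf Op.
  by rewrite /F /= cinvK.
Qed.

End Forward.

(** * Jordan bases of nilpotent matrices *)

Section Jordan.
Variables (K : fieldType) (m : nat) (A : 'M[K]_m).

(** Combinations of the Jordan chains [v i, v i A, ..., v i A^(s i - 1)]. *)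
Definition chain_comb D (v : 'I_D -> 'rV[K]_m) (s : 'I_D -> nat) (c : 'I_D -> nat -> K) :
    'rV[K]_m := \sum_i \sum_(a < s i) c i a *: (v i *m A ^+ a).

Definition chain_span D (v : 'I_D -> 'rV[K]_m) s (u : 'rV[K]_m) :=
  exists c, u = chain_comb v s c.

Definition chain_closed D (v : 'I_D -> 'rV[K]_m) s :=
  forall i, v i *m A ^+ s i = 0.

Definition chain_free D (v : 'I_D -> 'rV[K]_m) s :=
  forall c, chain_comb v s c = 0 -> forall i a, (a < s i)%N -> c i a = 0.

Section Span.
Variables (D : nat) (v : 'I_D -> 'rV[K]_m) (s : 'I_D -> nat).

Lemma chain_span0 : chain_span v s 0.
Proof.
by exists (fun _ _ => 0); rewrite /chain_comb big1// => i _; rewrite big1// => a _; rewrite scale0r.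
Qed.

Lemma chain_spanD x y : chain_span v s x -> chain_span v s y -> chain_span v s (x + y).
Proof.
move=> [c ->] [d ->]; exists (fun i a => c i a + d i a).
rewrite /chain_comb -big_split; apply: eq_bigr => i _ /=.
by rewrite -big_split; apply: eq_bigr => a _ /=; rewrite scalerDl.
Qed.

Lemma chain_spanZ k x : chain_span v s x -> chain_span v s (k *: x).
Proof.
move=> [c ->]; exists (fun i a => k * c i a).
rewrite /chain_comb scaler_sumr; apply: eq_bigr => i _ /=.
by rewrite scaler_sumr; apply: eq_bigr => a _ /=; rewrite scalerA.
Qed.

Hypothesis vs : chain_closed v s.

Lemma chain_span_gen i a : chain_span v s (v i *m A ^+ a).
Proof.
have [ai|ai] := ltnP a (s i); last first.
  rewrite -(subnKC ai) exprD -[_ * _]/(_ *m _) mulmxA vs mul0mx.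
  exact: chain_span0.
exists (fun j b => ((j == i) && (b == a))%:R).
rewrite /chain_comb (bigD1 i)//= (bigD1 (Ordinal ai))//= !eqxx scale1r.
rewrite big1 ?addr0 ?big1 ?addr0// => [j /negPf ji|b ba].
  by rewrite big1// => b _; rewrite ji scale0r.
by rewrite (_ : (b == a :> nat) = false) ?andbF ?scale0r//; exact/negbTE.
Qed.

Lemma chain_span_mul x a : chain_span v s x -> chain_span v s (x *m A ^+ a).
Proof.
move=> [c ->]; rewrite mulmx_suml; elim/big_ind: _ => [|x' y|i _]; first exact: chain_span0.
  exact: chain_spanD.
rewrite mulmx_suml; elim/big_ind: _ => [|x' y|b _]; first exact: chain_span0.
  exact: chain_spanD.
rewrite -scalemxAl -mulmxA -[A ^+ b *m _]/(A ^+ b * A ^+ a) -exprD.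
exact/chain_spanZ/chain_span_gen.
Qed.

(** Nakayama's lemma for the nilpotent matrix [A]: substituting the
    hypothesis into itself k times leaves a remainder in the image of A^k. *)
Lemma chain_nakayama n : A ^+ n = 0 ->
  (forall u, exists w x, chain_span v s w /\ u = w + x *m A) ->
  forall u, chain_span v s u.
Proof.
move=> An h.
have it k u : exists w x, chain_span v s w /\ u = w + x *m A ^+ k.
  elim: k => [|k [w [x [Ww ->]]]].
    by exists 0, u; split; [exact: chain_span0|rewrite add0r mulmx1].
  have [w' [x' [Ww' ->]]] := h x; exists (w + w' *m A ^+ k), x'; split.
    exact/chain_spanD/chain_span_mul.
  by rewrite mulmxDl addrA -mulmxA exprS.
move=> u; have [w [x [Ww ->]]] := it n u.
by rewrite An mulmx0 addr0.
Qed.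

End Span.

(** Given a nontrivial relation among the chains, let [e] be the least
    exponent that occurs, say in chain [i0].  The relation divided by A^e gives a
    vector [v0] killed by A^e, in which [v i0] has a nonzero coefficient modulo
    the image of [A] and the other chains.  Replacing [v i0] by [v0] shortens a
    chain and the chains still span, by Nakayama's lemma. *)
Lemma chain_reduce n D (v : 'I_D -> 'rV[K]_m) s : A ^+ n = 0 ->
  chain_closed v s -> (forall u, chain_span v s u) -> ~ chain_free v s ->
  exists v' s', [/\ chain_closed v' s', forall u, chain_span v' s' u &
     (\sum_(i < D) s' i < \sum_i s i)%N].
Proof.
move=> An vs sv /existsNP[c /not_implyP[c0 nc]].
have ex : exists e, [exists i, (e < s i)%N && (c i e != 0)].
  apply: contrapT => h; apply: nc => i a ai; apply: contrapT => /eqP cia.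
  by apply: h; exists a; apply/existsP; exists i; rewrite ai.
case: (ex_minnP ex) => e /existsP[i0 /andP[ei0 c00]] emin.
pose t i a := if (e <= a)%N then c i a *: (v i *m A ^+ (a - e)) else 0.
pose v0 := \sum_i \sum_(a < s i) t i a.
have v0e : v0 *m A ^+ e = 0.
  rewrite -c0 /v0 mulmx_suml; apply: eq_bigr => i _.
  rewrite mulmx_suml; apply: eq_bigr => a _; rewrite /t; case: leqP => ea.
    by rewrite -scalemxAl -mulmxA -[_ ^+ _ *m _]/(_ ^+ _ * _ ^+ _) -exprD subnK.
  rewrite mul0mx; apply/esym/eqP; rewrite scaler_eq0; apply/orP; left.
  apply: contraTT ea => cia; rewrite -leqNgt; apply: emin.
  by apply/existsP; exists i; rewrite ltn_ord.
pose v' i := if i == i0 then v0 else v i.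
pose s' i := if i == i0 then e else s i.
have vs' : chain_closed v' s' by move=> i; rewrite /v' /s'; case: eqP.
exists v', s'; split => //; last first.
  rewrite (bigD1 i0)//= [X in (_ < X)%N](bigD1 i0)//= {1}/s' eqxx.
  rewrite (eq_bigr s) => [|i /negPf ii0]; first by rewrite ltn_add2r.
  by rewrite /s' ii0.
apply: (chain_nakayama vs' An).
pose Q u := exists w x, chain_span v' s' w /\ u = w + x *m A.
have QW u : chain_span v' s' u -> Q u by exists u, 0; rewrite mul0mx addr0.
have QA u : Q (u *m A) by exists 0, u; rewrite add0r; split=> //; exact: chain_span0.
have QD u w : Q u -> Q w -> Q (u + w).
  move=> [x [y [Wx ->]]] [x' [y' [Wx' ->]]]; exists (x + x'), (y + y').
  by split; [exact: chain_spanD|rewrite mulmxDl addrACA].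
have QZ k u : Q u -> Q (k *: u).
  move=> [x [y [Wx ->]]]; exists (k *: x), (k *: y).
  by split; [exact: chain_spanZ|rewrite scalerDr scalemxAl].
have Q0 : Q 0 by apply: QW; exact: chain_span0.
have Qgen i a : (i != i0) || (0 < a)%N -> Q (v i *m A ^+ a).
  case: a => [|a]; last by rewrite exprSr -[_ * _]/(_ *m _) mulmxA.
  rewrite orbF => ii0; apply: QW.
  by have := chain_span_gen vs' i 0; rewrite (_ : v' i = v i)// /v' (negPf ii0).
have Qv0 : Q (v i0).
  have tE : t i0 e = c i0 e *: v i0 by rewrite /t leqnn subnn mulmx1.
  suff Qt : Q (t i0 e).
    by rewrite -[v i0](scalerK c00) -tE; exact: QZ.
  have Qv' : Q v0.
    have := chain_span_gen vs' i0 0; rewrite (_ : v' i0 = v0) ?mulmx1; first exact: QW.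
    by rewrite /v' eqxx.
  have Qt i a : (i != i0) || (a != e) -> Q (t i a).
    move=> h; rewrite /t; case: leqP => // ea; apply/QZ/Qgen.
    by case/orP: h => [->//|ae]; rewrite subn_gt0 [(e < a)%N]ltn_neqAle [e == a]eq_sym ae ea orbT.
  have v0E : v0 = t i0 e + (\sum_(a < s i0 | a != Ordinal ei0) t i0 a +
      \sum_(i | i != i0) \sum_(a < s i) t i a).
    by rewrite /v0 (bigD1 i0)//= (bigD1 (Ordinal ei0))//= addrA.
  have -> : t i0 e = v0 + (-1) *: (\sum_(a < s i0 | a != Ordinal ei0) t i0 a +
      \sum_(i | i != i0) \sum_(a < s i) t i a) by rewrite scaleN1r v0E addrK.
  apply: (QD _ _ Qv'); apply/(QZ)/(QD).
    elim/big_ind: _ => [//|x y|a ae]; first exact: QD.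
    by apply: Qt; rewrite orbC -val_eqE /= in ae *; rewrite ae.
  elim/big_ind: _ => [//|x y|i ii0]; first exact: QD.
  elim/big_ind: _ => [//|x y|a _]; first exact: QD.
  by apply: Qt; rewrite ii0.
move=> u; have [d ->] := sv u; change (Q (chain_comb v s d)); rewrite /chain_comb.
elim/big_ind: _ => [//|x y|i _]; first exact: QD.
elim/big_ind: _ => [//|x y|a _]; first exact: QD.
apply: QZ.
case: a => a /= _; have [->|ii0] := eqVneq i i0; last by apply: Qgen; rewrite ii0.
case: (posnP a) => [->|a0]; first by rewrite mulmx1.
by apply: Qgen; rewrite a0 orbT.
Qed.

Lemma chain_basis n D (v : 'I_D -> 'rV[K]_m) s : A ^+ n = 0 ->
  chain_closed v s -> (forall u, chain_span v s u) ->
  exists (v' : 'I_D -> 'rV[K]_m) s', [/\ chain_closed v' s', forall u, chain_span v' s' u &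
     chain_free v' s'].
Proof.
move=> An; have [k] := ubnP (\sum_i s i)%N; elim: k => // k IH in v s * => sk vs sv.
have [fr|nfr] := pselect (chain_free v s); first by exists v, s.
have [v' [s' [vs' sv' ss']]] := chain_reduce An vs sv nfr.
by apply: (IH v' s') => //; apply: leq_trans ss' _; rewrite -ltnS.
Qed.

Lemma nilpotent_chain_basis n : A ^+ n.+1 = 0 ->
  exists (v : 'I_m -> 'rV[K]_m) s, [/\ chain_closed v s, forall u, chain_span v s u &
     chain_free v s].
Proof.
move=> An; apply: (@chain_basis n.+1 m (fun i => delta_mx 0 i) (fun=> n.+1) An).
  by move=> i; rewrite An mulmx0.
move=> u; exists (fun i a => if a is 0 then u 0 i else 0).
rewrite [LHS]row_sum_delta; apply: eq_bigr => i _.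
by rewrite big_ord_recl big1 ?addr0 ?mulmx1// => a _; rewrite /= scale0r.
Qed.

End Jordan.

(** The chains of length zero are dropped, the others sorted by length; the
    remaining chain vectors form a basis, so they are indexed by ['I_m], and they
    are the rows of [P]. *)
Lemma nilpotent_jordan (K : fieldType) (m n : nat) (A : 'M[K]_m) : A ^+ n.+1 = 0 ->
  exists (D : nat) (s : 'I_D -> nat) (lab : 'I_D -> nat -> 'I_m) (P : 'M[K]_m),
    [/\ P \in unitmx, forall i, (0 < s i)%N, forall i j : 'I_D, (i <= j)%N -> (s i <= s j)%N,
      set_bij [set ia : 'I_D * nat | (ia.2 < s ia.1)%N] [set: 'I_m] (fun ia => lab ia.1 ia.2)
    & forall i, row (lab i 0%N) P *m A ^+ s i = 0 /\
        forall a, (a < s i)%N -> row (lab i a) P = row (lab i 0%N) P *m A ^+ a].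
Proof.
move=> /nilpotent_chain_basis[v0 [s0 [v0s sp0 fr0]]].
pose le_s (i j : 'I_m) := (s0 i <= s0 j)%N.
pose l := sort le_s [seq i <- enum 'I_m | 0 < s0 i]%N.
have l_uniq : uniq l by rewrite sort_uniq filter_uniq ?enum_uniq.
have l_mem i : (i \in l) = (0 < s0 i)%N by rewrite mem_sort mem_filter mem_enum andbT.
have l_sorted : sorted le_s l by apply: sort_sorted => i j; exact: leq_total.
pose sg (i : 'I_(size l)) := tnth (in_tuple l) i.
have sg_inj i j : sg i = sg j -> i = j.
  by move=> /eqP; rewrite /sg !(tnth_nth (sg i)) nth_uniq// => /eqP/val_inj.
pose s i := s0 (sg i).
have s_pos i : (0 < s i)%N by rewrite -l_mem mem_tnth.
pose b (x : {i : 'I_(size l) & 'I_(s i)}) : 'rV[K]_m := v0 (sg (tag x)) *m A ^+ (tagged x).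
have combE (c : 'I_m -> nat -> K) : chain_comb A v0 s0 c =
    \sum_(x : {i : 'I_(size l) & 'I_(s i)}) c (sg (tag x)) (tagged x) *: b x.
  rewrite /chain_comb (bigID (mem l))/= [X in _ + X]big1 ?addr0; last first.
    move=> i; rewrite l_mem -eqn0Ngt => /eqP si.
    by rewrite big1// => -[a ai] _; exfalso; rewrite si in ai.
  rewrite -big_uniq//= big_tnth.
  by rewrite (sig_big_dep (fun=> true) (fun _ _ => true)
    (fun (i : 'I_(size l)) (a : 'I_(s i)) => c (sg i) a *: (v0 (sg i) *m A ^+ a))).
pose B : 'M[K]_(#|{: {i : 'I_(size l) & 'I_(s i)}}|, m) := \matrix_k b (enum_val k).
have BE (u : 'rV_(#|{: {i : 'I_(size l) & 'I_(s i)}}|)) : u *m B =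
    \sum_(x : {i : 'I_(size l) & 'I_(s i)}) u 0 (enum_rank x) *: b x.
  rewrite mulmx_sum_row (reindex enum_rank) /=; last exact/onW_bij/enum_rank_bij.
  by apply: eq_bigr => x _; rewrite rowK enum_rankK.
have Bfree : row_free B.
  apply/inj_row_free => u uB; pose c i a : K :=
    if [pick x : {i : 'I_(size l) & 'I_(s i)} | (sg (tag x) == i) && (tagged x == a :> nat)]
      is Some x then u 0 (enum_rank x) else 0.
  have cE (x : {i : 'I_(size l) & 'I_(s i)}) : c (sg (tag x)) (tagged x) = u 0 (enum_rank x).
    rewrite /c; case: pickP => [y /andP[/eqP/sg_inj]|/(_ x)]; last by rewrite !eqxx.
    case: x y => [i a] [j d] /= ji; move: ji d => -> d /eqP da.
    by congr (u 0 (enum_rank _)); congr existT; exact: val_inj.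
  have /fr0 c0 : chain_comb A v0 s0 c = 0.
    by rewrite combE; under eq_bigr do rewrite cE; rewrite -BE.
  apply/rowP => k; rewrite mxE -(enum_valK k) -cE; exact: c0 (ltn_ord _).
have Bfull : row_full B.
  rewrite -sub1mx; apply/row_subP => k; have [c ->] := sp0 (row k 1%:M).
  rewrite combE summx_sub// => x _; apply: scalemx_sub.
  by have <- : row (enum_rank x) B = b x; [rewrite rowK enum_rankK|exact: row_sub].
have card_m : #|{: {i : 'I_(size l) & 'I_(s i)}}| = m.
  by move/eqP: Bfree => <-; exact/eqP.
pose ix i (a : 'I_(s i)) : 'I_m := cast_ord card_m (enum_rank (Tagged (fun i => 'I_(s i)) a)).
pose lab i a : 'I_m := if insub a is Some a' then @ix i a' else sg i.
have labE i (a : 'I_(s i)) : lab i a = ix i a by rewrite /lab valK.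
pose P : 'M[K]_m := \matrix_k b (enum_val (cast_ord (esym card_m) k)).
have rowP_ i (a : 'I_(s i)) : row (lab i a) P = v0 (sg i) *m A ^+ a.
  by rewrite labE rowK /ix cast_ordK enum_rankK.
exists (size l), s, lab, P; split=> //.
- rewrite -row_full_unit -sub1mx (submx_trans _ (_ : (B <= P)%MS))// ?sub1mx//.
  apply/row_subP => k; have -> : row k B = row (cast_ord card_m k) P by rewrite !rowK cast_ordK.
  exact: row_sub.
- move=> i j ij; rewrite /s /sg !(tnth_nth (sg i)).
  apply: (sorted_leq_nth _ _ (sg i) l_sorted) => //; try by rewrite inE ltn_ord.
    by move=> x y z; exact: leq_trans.
  by move=> x; exact: leqnn.
- split=> //.
  + move=> [i a] [j d]; rewrite !inE /= => ai dj.
    rewrite (labE i (Ordinal ai)) (labE j (Ordinal dj)) => /cast_ord_inj/enum_rank_inj e.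
    have := congr1 (fun x : {i : 'I_(size l) & 'I_(s i)} => (tag x, nat_of_ord (tagged x))) e.
    by [].
  + move=> k _; case xE : (enum_val (cast_ord (esym card_m) k)) => [i a].
    exists (i, nat_of_ord a) => /=; first exact: ltn_ord.
    rewrite labE /ix; have -> : Tagged (fun i => 'I_(s i)) a = enum_val (cast_ord (esym card_m) k).
      by rewrite xE.
    by rewrite enum_valK cast_ordKV.
- move=> i; have r0 : row (lab i 0%N) P = v0 (sg i).
    by rewrite (rowP_ i (Ordinal (s_pos i))) mulmx1.
  split; first by rewrite r0; exact: v0s.
  by move=> a ai; rewrite (rowP_ i (Ordinal ai)) r0.
Qed.

(** * Nilomorphic coordinates centred at a point *)

Lemma open_preimage_in (S S' : topologicalType) (A : set S) (B : set S') (h : S -> S') :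
  open A -> (forall x, A x -> {for x, continuous h}) -> open B ->
  open [set x | A x /\ B (h x)].
Proof.
move=> oA ch oB; rewrite openE => x [Ax Bx]; apply: filterI.
  exact: open_nbhs_nbhs.
exact: ch Ax _ (open_nbhs_nbhs (conj oB Bx)).
Qed.

Section ChartTheory.
Variables (R : realType) (T : topologicalType) (m : nat) (X : manifold R T m).
Implicit Types c : chart R T m.

Lemma cinvK c p : atlas X c -> dom c p -> cinv c (coord c p) = p.
Proof. by move=> /atlas_chart[_ _ h _ _]; exact: h. Qed.

Lemma dom_cinv c u : atlas X c -> (coord c @` dom c) u ->
  dom c (cinv c u) /\ coord c (cinv c u) = u.
Proof. by move=> ca [p cp <-]; rewrite (cinvK ca). Qed.

Lemma chart_image_open c W : is_chart c -> open W -> open (coord c @` (dom c `&` W)).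
Proof.
move=> [oc oi cK _ ci] oW.
have -> : coord c @` (dom c `&` W) = [set u | (coord c @` dom c) u /\ W (cinv c u)].
  apply/seteqP; split=> u /=.
    by move=> [p [cp Wp] <-]; split; [exists p|rewrite cK].
  by move=> [[p cp <-]]; rewrite cK// => Wp; exists p.
exact: open_preimage_in.
Qed.

Lemma transition_differentiable c c' p : atlas X c -> atlas X c' ->
  dom c p -> dom c' p -> differentiable (transition c c') (coord c p).
Proof.
move=> ca c'a cp c'p; have [h _] := @atlas_smooth _ _ _ X _ _ ca c'a 1%N.
by apply: h; exists p.
Qed.

(** Membership of a vector in the distribution does not depend on the
    chart. *)
Definition transported (Delta : distribution R T m) := forall c c' p (v : 'rV[R]_m),
  atlas X c -> atlas X c' -> dom c p -> dom c' p ->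
  (v <= Delta c p)%MS -> (v *m 'J (transition c c') (coord c p) <= Delta c' p)%MS.

(** A straight segment in one chart is a curve tangent to the distribution,
    as seen in every chart. *)
Lemma segment_leaf (Delta : distribution R T m) c (u v : 'rV[R]_m) :
  transported Delta -> atlas X c ->
  (forall t : R, 0 <= t <= 1 -> (coord c @` dom c) (u + t *: v) /\
     (v <= Delta c (cinv c (u + t *: v)))%MS) ->
  leaf X Delta (dom c) (cinv c u) (cinv c (u + v)).
Proof.
move=> tr ca huv; exists (fun t => cinv c (u + t *: v)); split.
- by rewrite scale0r addr0.
- by rewrite scale1r.
move=> t t01; have [Ou vD] := huv t t01; have [dp cpE] := dom_cinv ca Ou.
have ct : {for t, continuous (fun t : R => u + t *: v)}.
  have [dl _] := @is_derive_line _ _ _ id u v t (@ex_diff _ _ _ _ _ _ _ (is_diff_id _)).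
  exact/differentiable_continuous/derivable1_diffP.
split=> //.
  apply: (@continuous_comp _ _ _ (fun t : R => u + t *: v) (cinv c)) => //.
  by have [_ _ _ _] := atlas_chart ca; apply.
move=> c' c'a c'p.
have dtr := transition_differentiable ca c'a dp c'p.
rewrite cpE in dtr.
have [dl lE] := is_derive_line dtr.
split; first exact: dl.
rewrite (_ : 'D_1 _ t = v *m 'J (transition c c') (coord c (cinv c (u + t *: v)))).
  exact: tr.
by rewrite cpE -deriveEjacobian// [RHS]deriveE//; exact: lE.
Qed.

Variable N : endo_field X.

Lemma transported_ImN : transported (ImN N).
Proof.
move=> c c' p v ca c'a cp c'p /submxP[w ->].
by rewrite -mulmxA (endo_compat N ca c'a cp c'p) mulmxA submxMl.
Qed.

Lemma transported_KerN a : transported (KerN N a).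
Proof.
move=> c c' p v ca c'a cp c'p /sub_kermxP vN; apply/sub_kermxP.
have e : (N c p ^+ a) *m 'J (transition c c') (coord c p) =
    'J (transition c c') (coord c p) *m (N c' p ^+ a).
  elim: a {vN} => [|a IH]; first by rewrite mul1mx mulmx1.
  rewrite exprSr -[_ * N c p]/(_ *m N c p) -mulmxA (endo_compat N ca c'a cp c'p).
  by rewrite mulmxA IH -mulmxA exprSr.
by rewrite -mulmxA -e mulmxA vN mul0mx.
Qed.

End ChartTheory.

Section AffineChart.
Variables (R : realType) (T : topologicalType) (m : nat) (X : manifold R T m).
Variables (c1 : chart R T m) (P : 'M[R]_m) (U : set T) (p0 : T).
Hypotheses (c1a : atlas X c1) (Pu : P \in unitmx) (oU : open U).
Hypotheses (c1p0 : dom c1 p0) (Up0 : U p0).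

Let a0 := coord c1 p0.
Let L (u : 'rV[R]_m) := mulmxr P u + a0.
Let L' (u : 'rV[R]_m) := mulmxr (invmx P) u + - (a0 *m invmx P).

Let LK u : L' (L u) = u.
Proof. by rewrite /L' /L /= mulmxDl mulmxK// addrK. Qed.

Let L'K u : L (L' u) = u.
Proof. by rewrite /L' /L /= mulmxBl !mulmxKV// subrK. Qed.

(** The chart [c1] recentred at [p0], expressed in the basis of the rows of
    [P], and restricted to a box. *)
Definition affine_chart (r : R) : chart R T m :=
  Chart [set q | dom c1 q /\ ball (0 : 'rV[R]_m) r (L' (coord c1 q))]
    (L' \o coord c1) (cinv c1 \o L).

Let continuous_affine (Q : 'M[R]_m) (z : 'rV[R]_m) :
  continuous (fun u : 'rV[R]_m => mulmxr Q u + z).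
Proof.
move=> x; apply: (@continuousD _ _ _ (mulmxr Q) (fun=> z)); last exact: cst_continuous.
exact: row_linear_continuous.
Qed.

Lemma affine_chart_exists : exists r : R,
  [/\ 0 < r, atlas X (affine_chart r), dom (affine_chart r) `<=` U,
      dom (affine_chart r) p0 /\ coord (affine_chart r) p0 = 0 &
      coord (affine_chart r) @` dom (affine_chart r) = ball (0 : 'rV[R]_m) r].
Proof.
have ch1 := atlas_chart c1a; have [op1 oi1 cK1 cc1 ci1] := (ch1).
have oO : open (coord c1 @` (dom c1 `&` U)) by exact: chart_image_open.
have L'a0 : L' a0 = 0.
  by rewrite /L' /= subrr.
have La0 : L 0 = a0 by rewrite -L'a0 L'K.
have [r r0 BO] : exists2 r : R, 0 < r &
    ball (0 : 'rV[R]_m) r `<=` [set u | (coord c1 @` (dom c1 `&` U)) (L u)].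
  have O0 : [set u | (coord c1 @` (dom c1 `&` U)) (L u)] 0.
    by rewrite /= La0; exists p0.
  have /nbhs_ballP[r r0 BO] := open_nbhs_nbhs (conj (@open_affine _ _ _ (mulmxr P) a0 _ oO) O0).
  by exists r.
have cL := @continuous_affine P a0.
have cL' := @continuous_affine (invmx P) (- (a0 *m invmx P)).
have c2K p : dom (affine_chart r) p -> cinv c1 (L (L' (coord c1 p))) = p.
  by move=> [cp _]; rewrite L'K cK1.
have c2U : dom (affine_chart r) `<=` U.
  move=> p [cp Bp]; have [q [cq Uq] e] := BO _ Bp.
  by rewrite -(c2K p)// -e cK1.
have imE : coord (affine_chart r) @` dom (affine_chart r) = ball (0 : 'rV[R]_m) r.
  apply/seteqP; split=> [_ [p [_ Bp] <-]//|u Bu].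
  have [q [cq Uq] e] := BO _ Bu; exists q; last by rewrite /= e LK.
  by split=> //; rewrite e LK.
have ch2 : is_chart (affine_chart r).
  split.
  - have cc p : dom c1 p -> {for p, continuous (L' \o coord c1)}.
      by move=> cp; apply: continuous_comp; [exact: cc1|exact: cL'].
    exact: (open_preimage_in op1 cc (ball_open (0 : 'rV[R]_m) r)).
  - by rewrite imE; exact: ball_open.
  - exact: c2K.
  - by move=> p [cp _]; apply: continuous_comp; [exact: cc1|exact: cL'].
  - rewrite imE => u Bu; apply: continuous_comp; first exact: cL.
    by apply: ci1; have [q [cq _] <-] := BO _ Bu; exists q.
exists r; split => //; last first.
  split; last by [].
  by split=> //; rewrite -/a0 L'a0; exact: ballxx.
apply: atlas_max ch2 _ => c' c'a; split=> k.
- have := @atlas_smooth _ _ _ X _ _ c1a c'a k.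
  have oA : open (coord c1 @` (dom c1 `&` dom c')).
    by apply: chart_image_open => //; have [] := atlas_chart c'a.
  move=> /(Ck_precomp (mulmxr P) a0 oA); apply: Ck_sub => _ [p [[cp _] c'p] <-] /=.
  by rewrite -/(L _) L'K; exists p.
- have := @atlas_smooth _ _ _ X _ _ c'a c1a k.
  have oA : open (coord c' @` (dom c' `&` dom c1)).
    by apply: chart_image_open => //; exact: (atlas_chart c'a).
  move=> /(Ck_linear (@row_linear_continuous _ _ _ (mulmxr (invmx P))) oA) CkL.
  have := CkD oA CkL (@Ck_cst _ _ _ k (coord c' @` (dom c' `&` dom c1)) (- (a0 *m invmx P))).
  by apply: Ck_sub => _ [p [c'p [cp _]] <-]; exists p.
Qed.

Lemma affine_chart_jacobian r p : atlas X (affine_chart r) -> dom (affine_chart r) p ->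
  'J (transition (affine_chart r) c1) (coord (affine_chart r) p) = P.
Proof.
move=> c2a c2p; have [cp _] := c2p.
have ch1 := atlas_chart c1a; have [_ o2 _ _ _] := atlas_chart c2a.
have dt := transition_differentiable c2a c1a c2p cp.
have near_eq : \forall u \near coord (affine_chart r) p,
    transition (affine_chart r) c1 u = L u.
  have Op : (coord (affine_chart r) @` dom (affine_chart r)) (coord (affine_chart r) p) by exists p.
  apply: filterS (open_nbhs_nbhs (conj o2 Op)) => _ [q [cq _] <-].
  by rewrite /transition /= L'K (cinvK c1a).
apply/row_matrixP => k; rewrite !rowE -deriveEjacobian// (near_eq_derive _ near_eq).
have /= := @derive_precomp _ _ _ _ (mulmxr P) a0 id (coord (affine_chart r) p) (delta_mx 0 k).
by rewrite derive_id => <-.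
Qed.

End AffineChart.

Section CentredCoordinates.
Variables (R : realType) (T : topologicalType) (m n : nat) (X : manifold R T m).
Variables (N : endo_field X) (U : set T) (p0 : T).
Hypotheses (hN : nilpotent_structure n.+1 N) (oU : open U) (Up0 : U p0).

(** Along a leaf of Im N the coordinates x are constant.  Conversely two
    points of a box with the same x are joined by a segment, whose direction is a
    combination of vectors d/dy_(i,a), all in the image of N. *)
Lemma box_proj D (s : 'I_D -> nat) (lab : 'I_D -> nat -> 'I_m) (c : chart R T m) (r : R) :
  (forall i j a b, (a < s i)%N -> (b < s j)%N -> lab i a = lab j b -> i = j /\ a = b) ->
  (forall k, exists i a, (a < s i)%N /\ k = lab i a) ->
  (forall i, (0 < s i)%N) ->
  atlas X c ->
  (forall p, dom c p -> forall i a, (a < s i)%N ->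
    delta_mx 0 (lab i a) = delta_mx 0 (lab i 0%N) *m N c p ^+ a :> 'rV[R]_m) ->
  (forall p, dom c p -> forall i,
    delta_mx 0 (lab i 0%N) *m N c p ^+ s i = 0 :> 'rV[R]_m) ->
  coord c @` dom c = ball (0 : 'rV[R]_m) r ->
  forall p q, dom c p -> dom c q ->
    (xcoord c lab p = xcoord c lab q <-> proj N (dom c) p = proj N (dom c) q).
Proof.
move=> lab_inj lab_surj s_pos ca int iend img p q cp cq.
have leaf_x a b : proj N (dom c) a b -> xcoord c lab b = xcoord c lab a.
  move=> [gam [<- <- hgam]].
  apply: (leaf_ImN_x_part lab_inj lab_surj s_pos ca (fun _ => id) int iend hgam).
  by rewrite ler01 lexx.
have x_leaf a b : dom c a -> dom c b -> xcoord c lab a = xcoord c lab b -> proj N (dom c) a b.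
  move=> da db xab.
  have ball_c d : dom c d -> ball (0 : 'rV[R]_m) r (coord c d) by rewrite -img; exists d.
  rewrite /proj -(cinvK ca da) -(cinvK ca db) -[coord c b](subrKC (coord c a)).
  apply: (segment_leaf (@transported_ImN _ _ _ _ N) ca) => t t01.
  have Oc : (coord c @` dom c) (coord c a + t *: (coord c b - coord c a)).
    rewrite img; apply: (ball_segment t01 (ball_c _ da)).
    by rewrite subrKC; exact: ball_c.
  split=> //; have [cd _] := dom_cinv ca Oc.
  rewrite [X in (X <= _)%MS]row_sum_delta; apply: summx_sub => k _.
  have [i [[|e] [ei ->]]] := lab_surj k.
    by have /rowP/(_ i) := xab; rewrite !mxE => ->; rewrite subrr scale0r sub0mx.
  by apply: scalemx_sub; rewrite (int _ cd)// exprSr -[_ * _]/(_ *m _) mulmxA submxMl.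
split=> [xpq|ppq]; last first.
  by apply: (leaf_x q p); rewrite -ppq; exact: leaf_refl.
have dl a b : proj N (dom c) a b -> dom c b.
  by move=> [gam [_ <- /(_ 1)]]; rewrite ler01 lexx => -[].
apply/seteqP; split=> a la.
- by apply: x_leaf => //; [exact: dl la|rewrite (leaf_x _ _ la)].
- by apply: x_leaf => //; [exact: dl la|rewrite (leaf_x _ _ la)].
Qed.

Lemma centred_coordinates : exists (D : nat) (s : 'I_D -> nat) (c : chart R T m)
    (lab : 'I_D -> nat -> 'I_m) (r : R),
  [/\ 0 < r, nilomorphic_coordinates N U s c lab, dom c p0, coord c p0 = 0 &
      coord c @` dom c = ball (0 : 'rV[R]_m) r].
Proof.
have [nil _ /(_ p0)[c1 [c1a c1p0 [A NA]]]] := hN.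
have An : A ^+ n.+1 = 0 by rewrite -(NA _ c1p0) nil.
have [D [s [lab [P [Pu s_pos s_sorted lab_bij chains]]]]] := nilpotent_jordan An.
have [r [r0 c2a c2U [c2p0 c20] img]] := affine_chart_exists c1a Pu oU c1p0 Up0.
set c := affine_chart c1 P p0 r in c2a c2U c2p0 c20 img.
have NP p : dom c p -> N c p *m P = P *m A.
  move=> cp; have [c1p _] := cp.
  by rewrite -(affine_chart_jacobian c1a Pu c2a cp) (endo_compat N c2a c1a cp c1p) (NA _ c1p).
have NPa p a : dom c p -> N c p ^+ a *m P = P *m A ^+ a.
  move=> cp; elim: a => [|a IH]; first by rewrite mul1mx mulmx1.
  by rewrite exprS -[_ * _]/(_ *m _) -mulmxA IH mulmxA NP// -mulmxA exprS.
have Pinj (u v : 'rV[R]_m) : u *m P = v *m P -> u = v.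
  by move/(congr1 (mulmx^~ (invmx P))); rewrite !mulmxK.
have int p : dom c p -> forall i a, (a < s i)%N ->
    delta_mx 0 (lab i a) = delta_mx 0 (lab i 0%N) *m N c p ^+ a :> 'rV[R]_m.
  move=> cp i a ai; apply: Pinj; rewrite -mulmxA NPa// mulmxA -!rowE.
  exact: (chains i).2.
have iend p : dom c p -> forall i, delta_mx 0 (lab i 0%N) *m N c p ^+ s i = 0 :> 'rV[R]_m.
  move=> cp i; apply: Pinj; rewrite -mulmxA NPa// mulmxA -!rowE mul0mx.
  exact: (chains i).1.
have [_ lab_inj lab_surj] := lab_bij.
exists D, s, c, lab, r; split=> //; split=> //.
apply: (box_proj (s := s) (r := r)) => //.
- move=> i j a b ai bj e.
  by have := lab_inj (i, a) (j, b); rewrite !inE => /(_ ai bj e)[-> ->].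
- by move=> k; have [[i a] /= ai <-] := lab_surj k Logic.I; exists i, a.
Qed.

End CentredCoordinates.

(** * From the expansion to nilomorphic functions *)

Section ExpansionAtZero.
Variables (R : realType) (D n : nat) (M : normedModType R) (nuM : nu_module n.+1 M).
Variables (g : 'rV[R]_D -> M).
Local Notation Rn := (Rnu R n.+1).

(** The right-hand side of the expansion as a function of the nilpotent
    displacement and of the base point. *)
Definition expansion (w : 'I_D -> Rn) (x : 'rV[R]_D) : M :=
  \sum_(al : {ffun 'I_D -> 'I_n.+1} | (\sum_i al i < n.+1)%N)
    ((\prod_i (al i)`!)%:R : R)^-1 *:
      nuM (\prod_i w i ^+ al i) (mpartial al g x).

Lemma mem_index_seq (al : {ffun 'I_D -> 'I_n.+1}) l j : j \in index_seq al l -> (0 < al j)%N.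
Proof.
by case/flattenP => _ /mapP[i _ ->]; rewrite mem_nseq => /andP[ai /eqP ->].
Qed.

Lemma expansion0 x : expansion (fun=> 0) x = g x.
Proof.
rewrite /expansion (bigD1 [ffun=> ord0]) /=; last first.
  by rewrite big1// => i _; rewrite ffunE.
rewrite [X in X%:R^-1]big1; last by move=> i _; rewrite ffunE.
rewrite [X in nuM X]big1; last by move=> i _; rewrite ffunE expr0.
rewrite act1 invr1 scale1r mpartialE (_ : index_seq _ _ = [::]); last first.
  by apply: size0nil; rewrite size_index_seq big1// => i _; rewrite ffunE.
rewrite big1 ?addr0// => al /andP[_ al0].
have [i ai] : exists i, al i != ord0.
  apply: contrapT => h; move/eqP: al0; apply; apply/ffunP => i; rewrite ffunE.
  by apply/eqP; apply: contrapT => /negP ai; apply: h; exists i.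
by rewrite [X in nuM X](bigD1 i)//= expr0n (negPf (ai : al i != 0%N :> nat)) mul0r act0l scaler0.
Qed.

(** Only the multi-index of weight one supported at [i] contributes to the
    derivative at zero. *)
Lemma expansion_derive (i : 'I_D) (om : Rn) x : (0 < n)%N ->
  is_derive (0 : R) 1 (fun t : R => expansion (fun j => t *: (if j == i then om else 0)) x)
    (nuM om (partial i g x)).
Proof.
move=> n0; pose w j := if j == i then om else 0.
pose c (al : {ffun 'I_D -> 'I_n.+1}) : Rn := ((\prod_i (al i)`!)%:R : R)^-1 *: \prod_i w i ^+ al i.
pose H (al : {ffun 'I_D -> 'I_n.+1}) (t : R) := t ^+ (\sum_i al i) *: mpartial al g x.
have dH al : is_derive (0 : R) 1 (H al)
    (((\sum_i al i)%N%:R * 0 ^+ (\sum_i al i).-1) *: mpartial al g x).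
  apply: is_derive_scalel.
  by apply: DeriveDef; [exact: exprn_derivable|rewrite exp_derive [_ *: 1]mulr1].
have -> : (fun t : R => expansion (fun j => t *: (if j == i then om else 0)) x) =
    (fun t => \sum_(al : {ffun 'I_D -> 'I_n.+1} | (\sum_i al i < n.+1)%N) nuM (c al) (H al t)).
  apply/funext => t; apply: eq_bigr => al _; rewrite /H /c actZr actZl scalerA mulrC -scalerA.
  congr (_ *: _); rewrite -actZl; congr (nuM _ _).
  by under eq_bigr do rewrite exprZn; rewrite scaler_prod prodrXr.
apply: is_derive_eq.
  apply: is_derive_act_sum => al _; right.
  by apply/derivable1_diffP; case: (dH al).
pose d : {ffun 'I_D -> 'I_n.+1} := [ffun j => if j == i then inord 1 else ord0].
have dE j : d j = (j == i) :> nat by rewrite ffunE; case: eqP => // _; rewrite inordK.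
have sd : (\sum_j d j = 1)%N.
  by rewrite (bigD1 i)//= dE eqxx big1// => j /negPf ji; rewrite dE ji.
rewrite (bigD1 d) /= ?sd//= [X in _ + X]big1 ?addr0; last first.
  move=> al /andP[_ ald]; have [_ ->] := dH al.
  have [sal|sal] := eqVneq (\sum_j al j)%N 1%N; last first.
    rewrite [X in X *: _](_ : _ = 0) ?scale0r ?linear0//.
    case: (\sum_j al j)%N sal => [|[|k]] //= _; first by rewrite mul0r.
    by rewrite expr0n mulr0.
  have [j ji aj] : exists2 j, j != i & al j != ord0.
    apply: contrapT => h; move/eqP: ald; apply; apply/ffunP => j; apply: val_inj.
    have al0 k : k != i -> al k = ord0.
      by move=> ki; apply/eqP; apply: contrapT => /negP ak; apply: h; exists k.
    rewrite /= dE; have [->|ji] := eqVneq j i; last by rewrite al0.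
    by move: sal; rewrite (bigD1 i)//= big1 ?addn0// => k /al0 ->.
  rewrite /c [X in nuM (_ *: X)](bigD1 j)//= /w (negPf ji).
  by rewrite [0 ^+ al j]expr0n (negPf (aj : al j != 0%N :> nat)) mul0r scaler0 act0l.
have [_ ->] := dH d; rewrite sd /= expr0 mulr1 scale1r /c.
rewrite [X in X%:R^-1]big1; last by move=> j _; rewrite dE; case: (j == i).
rewrite invr1 scale1r (bigD1 i)//= big1 ?mulr1; last first.
  by move=> j /negPf ji; rewrite dE ji expr0.
rewrite dE eqxx expr1 /w eqxx mpartialE; congr (nuM _ _).
have sz : size (index_seq d (enum 'I_D)) = 1%N by rewrite size_index_seq big_enum.
have di j : j \in index_seq d (enum 'I_D) -> j = i.
  by move=> /mem_index_seq; rewrite dE; case: eqP.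
have l1 (l : seq 'I_D) : size l = 1%N -> (forall j, j \in l -> j = i) -> l = [:: i].
  by case: l => [|j []]// _ /(_ j); rewrite inE eqxx => ->.
by rewrite (l1 _ sz di).
Qed.

End ExpansionAtZero.

Lemma derive_line (R : realType) (V M : normedModType R) (F : V -> M) (u y : V) (t : R) :
  'D_1 (fun t : R => F (u + t *: y)) t = 'D_y F (u + t *: y).
Proof. by rewrite /derive line_quotient. Qed.

Section Backward.
Variables (R : realType) (T : topologicalType) (m : nat) (X : manifold R T m).
Variables (n : nat) (N : endo_field X) (U : set T) (M : normedModType R).
Variables (nuM : nu_module n.+1 M) (f : T -> M).
Variables (D : nat) (s : 'I_D -> nat) (c : chart R T m) (lab : 'I_D -> nat -> 'I_m) (r : R).
Variables (p0 : T) (fc : set T -> M) (g : 'rV[R]_D -> M).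
Hypothesis hc : nilomorphic_coordinates N U s c lab.
Hypotheses (r0 : 0 < r) (cp0 : dom c p0).
Hypothesis img : coord c @` dom c = ball (0 : 'rV[R]_m) r.
Hypothesis nilp : N c p0 ^+ n.+1 = 0.
Hypothesis had : adapted N nuM (dom c) fc.
Hypothesis gfc : forall p, dom c p -> g (xcoord c lab p) = fc (proj N (dom c) p).
Hypothesis fE : forall p, dom c p -> f p = nilo_expansion s c lab nuM g p.

Local Notation nu := ('qX : Rnu R n.+1).
Let F := f \o cinv c.
Hypothesis dF : differentiable F 0.

Let ca : atlas X c := nc_atlas hc.
Let lab_inj i j a b : (a < s i)%N -> (b < s j)%N -> lab i a = lab j b -> i = j /\ a = b.
Proof. exact: (nc_lab_inj hc). Qed.
Let lab_surj k : exists i a, (a < s i)%N /\ k = lab i a.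
Proof. exact: (nc_lab_surj hc). Qed.

(** A longer block would contain the nonzero vector N^(n+1) d/dx_i. *)
Let block_size i : (s i <= n.+1)%N.
Proof.
rewrite leqNgt; apply/negP => si.
have := nc_integral hc cp0 si; rewrite nilp mulmx0 => /rowP/(_ (lab i n.+1)).
by rewrite !mxE !eqxx => /eqP; rewrite oner_eq0.
Qed.

Let F_expansion u : ball (0 : 'rV[R]_m) r u ->
  F u = expansion nuM g (nu_y n s lab u) (x_part lab u).
Proof.
rewrite -img => Ou; have [du cu] := dom_cinv ca Ou.
by rewrite /F /= fE// /nilo_expansion /expansion /nuy /xcoord /nu_y /x_part cu.
Qed.

Let ball_line (v : 'rV[R]_m) : \forall t \near (0 : R), ball (0 : 'rV[R]_m) r (0 + t *: v).
Proof.
have ct : {for (0 : R), continuous (fun t : R => 0 + t *: v)}.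
  have [dl _] := @is_derive_line _ _ _ id 0 v 0 (@ex_diff _ _ _ _ _ _ _ (is_diff_id _)).
  exact/differentiable_continuous/derivable1_diffP.
have := ct (ball 0 r); apply; rewrite scale0r addr0; exact: nbhsx_ballx.
Qed.

Let F_line (v : 'rV[R]_m) : is_derive (0 : R) 1 (fun t : R => F (0 + t *: v)) ('d F 0 v).
Proof.
have d0 : differentiable F (0 + (0 : R) *: v) by rewrite scale0r addr0.
by have := is_derive_line d0; rewrite scale0r addr0.
Qed.

(** Along the x_i-axis y = 0, so the function coincides with [g]. *)
Lemma diff_x i : 'd F 0 (delta_mx 0 (lab i 0%N)) = 'D_(delta_mx 0 i) g 0.
Proof.
have [_ <-] := F_line (delta_mx 0 (lab i 0%N)).
rewrite -[X in 'D__ g X](addr0 0) -[X in 'D__ g (_ + X)](scale0r (delta_mx 0 i)) -derive_line.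
apply: near_eq_derive; apply: filterS (ball_line (delta_mx 0 (lab i 0%N))) => t Bt.
rewrite F_expansion// !add0r.
have -> : x_part lab (t *: delta_mx 0 (lab i 0%N)) = t *: delta_mx 0 i.
  apply/rowP => j; rewrite !mxE; congr (_ * (_ && _)%:R).
  apply/eqP/eqP => [/(lab_inj (nc_pos hc _) (nc_pos hc _))[]//|-> //].
rewrite -[RHS](expansion0 nuM); congr expansion; apply/funext => j.
rewrite /nu_y big_nat big1// => a /andP[a0 aj]; rewrite !mxE eqxx /=.
case: eqP => [/(lab_inj aj (nc_pos hc _))[_ a00]|_]; last by rewrite mulr0 scale0r.
by rewrite a00 in a0.
Qed.

(** Along the y_(i,b)-axis x = 0 and (nu y_i) = t nu^b. *)
Lemma diff_y i b : (0 < b < s i)%N ->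
  'd F 0 (delta_mx 0 (lab i b)) = nuM (nu ^+ b) ('d F 0 (delta_mx 0 (lab i 0%N))).
Proof.
move=> /andP[b0 bi]; rewrite diff_x; have n0 : (0 < n)%N by have := block_size i; lia.
have [_ <-] := F_line (delta_mx 0 (lab i b)).
have [_ <-] := expansion_derive nuM g i (nu ^+ b) 0 n0.
apply: near_eq_derive; apply: filterS (ball_line (delta_mx 0 (lab i b))) => t Bt.
rewrite F_expansion// !add0r.
have -> : x_part lab (t *: delta_mx 0 (lab i b)) = 0.
  apply/rowP => j; rewrite !mxE eqxx /=.
  case: eqP => [/(lab_inj (nc_pos hc _) bi)[_ b00]|_]; last by rewrite mulr0.
  by rewrite -b00 in b0.
congr expansion; apply/funext => j; rewrite nu_yZ; congr (_ *: _).
case: eqP => [->|ji].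
  rewrite /nu_y (bigD1_seq b) ?iota_uniq ?mem_index_iota ?b0//= mxE !eqxx scale1r.
  rewrite big_seq_cond big1 ?addr0// => a /andP[]; rewrite mem_index_iota => /andP[_ ai] ab.
  rewrite mxE eqxx /=; case: eqP => [/(lab_inj ai bi)[_ e]|_]; last by rewrite scale0r.
  by rewrite e eqxx in ab.
rewrite /nu_y big_nat big1// => a /andP[_ aj]; rewrite mxE eqxx /=.
by case: eqP => [/(lab_inj aj bi)[]//|_]; rewrite scale0r.
Qed.

(** The x_i-axis is tangent to ker N^(s i), so it projects into a leaf on
    which nu^(s i) g is constant. *)
Lemma diff_end i : nuM (nu ^+ s i) ('d F 0 (delta_mx 0 (lab i 0%N))) = 0.
Proof.
have [si|si] := ltnP (s i) n.+1; last by rewrite qXn_eq0// act0l.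
set e := delta_mx 0 (lab i 0%N).
have dl : differentiable (fun t : R => F (0 + t *: e)) 0.
  by apply/derivable1_diffP; case: (F_line e).
have [_ <-] := F_line e.
rewrite -(@derive_linear _ _ _ _ (@act_cont _ _ _ nuM (nu ^+ s i)))//.
rewrite (@near_eq_derive _ _ _ _ (cst (nuM (nu ^+ s i) (F 0)))) ?derive_cst//.
apply: filterS (ball_line e) => t Bt /=.
have inball (t' : R) : 0 <= t' <= 1 -> ball (0 : 'rV[R]_m) r (0 + t' *: (t *: e)).
  by move=> t'01; apply: (ball_segment t'01) => //; exact: ballxx.
have B0 : ball (0 : 'rV[R]_m) r 0 by exact: ballxx.
have [d0 cd0] : dom c (cinv c 0) /\ coord c (cinv c 0) = 0 by apply: (dom_cinv ca); rewrite img.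
have [dt cdt] : dom c (cinv c (0 + t *: e)) /\ coord c (cinv c (0 + t *: e)) = 0 + t *: e.
  by apply: (dom_cinv ca); rewrite img.
have Fg u : ball (0 : 'rV[R]_m) r u -> y_part s lab u = 0 -> F u = fc (proj N (dom c) (cinv c u)).
  move=> Bu yu; have [du cu] : dom c (cinv c u) /\ coord c (cinv c u) = u.
    by apply: (dom_cinv ca); rewrite img.
  rewrite -gfc// (_ : xcoord c lab _ = x_part lab u); last by rewrite -[u in RHS]cu.
  rewrite F_expansion// -[RHS](expansion0 nuM); congr expansion; apply/funext => j.
  by rewrite -(nu_y_y_part n lab_inj (nc_pos hc)) yu nu_y0.
rewrite !Fg//; last first.
- apply/rowP => k; rewrite !mxE add0r eqxx /=; have [->|_] := eqVneq k.
    by rewrite (is_y_label_x lab_inj (nc_pos hc)).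
  by rewrite mulr0; case: ifP.
- by apply/rowP => k; rewrite !mxE; case: ifP.
apply: (had si d0).
- exists (cinv c (0 + t *: e)) => //.
  apply: (segment_leaf (@transported_KerN _ _ _ _ N (s i)) ca) => t' t'01.
  rewrite img; split; first exact: inball.
  apply/sub_kermxP; rewrite -scalemxAl (nc_end hc) ?scaler0//.
  by apply: (dom_cinv ca _).1; rewrite img; exact: inball.
- by exists (cinv c 0) => //; exact: leaf_refl.
Qed.

Lemma nilomorphic_at_centre (v : 'rV[R]_m) : 'd F 0 (v *m N c p0) = nuM nu ('d F 0 v).
Proof.
rewrite (row_sum_delta v) mulmx_suml !linear_sum; apply: eq_bigr => k _ /=.
rewrite -scalemxAl !linearZ /=; congr (_ *: _).
have [i [a [ai ->]]] := lab_surj k.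
rewrite -[N c p0]expr1 (delta_lab_exp (nc_integral hc cp0) (nc_end hc cp0))//.
have da b : (b < s i)%N ->
    'd F 0 (delta_mx 0 (lab i b)) = nuM (nu ^+ b) ('d F 0 (delta_mx 0 (lab i 0%N))).
  by case: b => [|b] bi; [rewrite expr0 act1|exact: diff_y].
rewrite (da a)// actA -exprS addn1; case: ltnP => ai'; first exact: da.
have -> : a.+1 = s i by apply/eqP; rewrite eqn_leq ai ai'.
by rewrite diff_end linear0.
Qed.

End Backward.

Lemma derive_comp_jacobian (R : realType) (a b : nat) (M : normedModType R)
    (F : 'rV[R]_b -> M) (h : 'rV[R]_a -> 'rV[R]_b) (u v : 'rV[R]_a) :
  differentiable h u -> differentiable F (h u) ->
  'D_v (F \o h) u = 'd F (h u) (v *m 'J h u).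
Proof.
move=> dh dF.
have dFh : differentiable (F \o h) u by exact: differentiable_comp.
have hv : 'd h u v = v *m 'J h u by rewrite -deriveEjacobian// deriveE.
apply: (etrans (deriveE v dFh)).
by have -> := diff_comp dh dF; rewrite /= hv.
Qed.

(** The equation is invariant under changes of charts: the matrices of N
    are conjugate under the Jacobian, and differentials compose with it. *)
Lemma nilomorphic_transfer (R : realType) (T : topologicalType) (m : nat)
    (X : manifold R T m) (n : nat) (N : endo_field X) (M : normedModType R)
    (nuM : nu_module n M) (f : T -> M) (c c' : chart R T m) (p : T) :
  atlas X c -> atlas X c' -> dom c p -> dom c' p ->
  differentiable (f \o cinv c) (coord c p) ->
  (forall v : 'rV[R]_m, 'd (f \o cinv c) (coord c p) (v *m N c p) =
     nuM 'qX ('d (f \o cinv c) (coord c p) v)) ->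
  forall v : 'rV[R]_m, 'd (f \o cinv c') (coord c' p) (v *m N c' p) =
     nuM 'qX ('d (f \o cinv c') (coord c' p) v).
Proof.
move=> ca c'a cp c'p dF hF; pose tr := transition c' c.
have dtr : differentiable tr (coord c' p) by exact: (transition_differentiable c'a ca c'p cp).
have trp : tr (coord c' p) = coord c p by rewrite /tr /transition /= (cinvK c'a).
have dFt : differentiable (f \o cinv c) (tr (coord c' p)) by rewrite trp.
have near_eq : \forall u \near coord c' p, ((f \o cinv c) \o tr) u = (f \o cinv c') u.
  have oW : open (coord c' @` (dom c' `&` dom c)).
    by apply: (chart_image_open (atlas_chart c'a)); have [] := atlas_chart ca.
  have Wp : (coord c' @` (dom c' `&` dom c)) (coord c' p) by exists p.
  apply: filterS (open_nbhs_nbhs (conj oW Wp)) => _ [q [c'q cq] <-].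
  by rewrite /tr /transition /= (cinvK c'a)// (cinvK ca).
have dcomp : differentiable ((f \o cinv c) \o tr) (coord c' p) by exact: differentiable_comp.
have dF' : differentiable (f \o cinv c') (coord c' p) by exact: differentiable_near near_eq dcomp.
have dE v : 'd (f \o cinv c') (coord c' p) v =
    'd (f \o cinv c) (coord c p) (v *m 'J tr (coord c' p)).
  transitivity ('D_v ((f \o cinv c) \o tr) (coord c' p)).
    by rewrite -(deriveE _ dF'); apply/esym/near_eq_derive.
  by rewrite -[in RHS]trp; exact: derive_comp_jacobian.
move=> v; apply: (etrans (dE _)).
rewrite -mulmxA (endo_compat N c'a ca c'p cp) mulmxA.
exact: (etrans (hF _) (congr1 _ (esym (dE _)))).
Qed.

Theorem theorem2p9 (R : realType) (T : topologicalType) (m : nat)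
    (X : manifold R T m) (n : nat) (N : endo_field X)
    (hN : nilpotent_structure n N)
    (U : set T) (hU : open U)
    (hI : trivial_foliation X (ImN N) U)
    (hK : forall a : nat, (a < n)%N -> trivial_foliation X (KerN N a) U)
    (M : normedModType R) (nuM : nu_module n M)
    (f : T -> M) (hf : Ck_on X n.-1 U f) (hf1 : differentiable_on X U f) :
  nilomorphic N nuM U f <->
  (forall (D : nat) (s : 'I_D -> nat) (c : chart R T m)
          (lab : 'I_D -> nat -> 'I_m),
     nilomorphic_coordinates N U s c lab ->
     exists (fc : set T -> M) (g : 'rV[R]_D -> M),
       [/\ adapted N nuM (dom c) fc,
           forall p, dom c p -> g (xcoord c lab p) = fc (proj N (dom c) p),
           Ck n.-1 (xcoord c lab @` dom c) g
         & forall p, dom c p -> f p = nilo_expansion s c lab nuM g p]).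
Proof.
clear hI hK; case: n hN nuM hf => [|n] hN nuM hf.
  (* For n = 0 the zeroth power of N would be both zero and nonzero. *)
  have [nil [c [p [ca cp nz]]] _] := hN.
  by exfalso; move/eqP: nz; apply; exact: nil ca cp.
split=> [hnil D s c lab hc|hexp]; first exact: (nilomorphic_expansion hf hnil hc).
split=> // c' p c'a c'p Up.
have [D [s [c [lab [r [r0 hc cp c0 img]]]]]] := centred_coordinates hN hU Up.
have [fc [g [had gfc _ fE]]] := hexp D s c lab hc.
have ca := nc_atlas hc; have [nil _ _] := hN.
have dF : differentiable (f \o cinv c) (coord c p) by exact: hf1.
apply: (nilomorphic_transfer ca c'a cp c'p dF) => v.
rewrite c0 in dF *.
exact: (nilomorphic_at_centre hc r0 cp img (nil _ _ ca cp) had gfc fE dF).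
Qed.
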